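(* Let $1<p\leq 2$, $\Gamma=\Gamma_p$, and let $f$ satisfy: (1) $f\in C^1(\Gamma)\cap C^0(\bar{\Gamma})$ is symmetric, i.e. $f(\lambda_1,\lambda_2)=f(\lambda_2,\lambda_1)$; (2) $f$ is homogeneous of degree $1$; (3) $f>0$ and $f_{\lambda_i}:=\frac{\partial f}{\partial\lambda_i}>0$ in $\Gamma$ for $i=1,2$, and $f|_{\partial\Gamma}=0$; (4) $f$ is concave in $\Gamma$. Let $\{K_i\}$ be a sequence of positive $C^2$ functions on $\mathbb{S}^2$ satisfying, for some positive constants $c_1$ and $C_2$, $\min_{\mathbb{S}^2}K_i\geq c_1>0$ and $\sup\|K_i\|_{C^2(\mathbb{S}^2)}\leq C_2<\infty$ for all $i$, and let $\{u_i\}\subset C^2(\mathbb{S}^2)$ be a sequence of functions satisfying $$f(\lambda(g_{u_i}^{-1}A_{g_{u_i}}))=K_i,\quad \lambda(g_{u_i}^{-1}A_{g_{u_i}})\in\Gamma_p\quad\text{on }\mathbb{S}^2,$$ and, with $x_i\in\mathbb{S}^2$, $$u_i(x_i)=\max_{\mathbb{S}^2}u_i\rightarrow\infty.$$ Then for some constant $C>0$ depending only on $p$, $c_1$ and $C_2$, $$u_i(x)\leq -2\ln d_g(x,x_i)+C\quad\text{for all }x\in\mathbb{S}^2\setminus\{x_i\}.$$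
   Context: $(\mathbb{S}^2,g)$ is the standard round two sphere, with Gaussian curvature $K_g\equiv 1$, and $d_g(x,x_i)$ is the distance between $x$ and $x_i$ in the metric $g$. For $1\le p\le 2$, $\Gamma_p:=\{(\lambda_1,\lambda_2)\in\mathbb{R}^2:\lambda_2>(p-2)\lambda_1,\ \lambda_1>(p-2)\lambda_2\}$. For a function $u$ on $\mathbb{S}^2$, $g_u=e^ug$ and $$A_{g_u}:=-\nabla_{g}^2u+\tfrac{1}{2}du\otimes du-\tfrac{1}{4}|\nabla_{g} u|^2g+K_{g} g,$$ and $\lambda(g_u^{-1}A_{g_u})$ denotes the eigenvalues of $g_u^{-1}A_{g_u}$.
   Formalization: The constant C is allowed to depend also on the fixed function f, not only on p, c_1 and C_2; independence of f is false, since replacing f by tf and u_i by u_i + ln t keeps every hypothesis with the same K_i. *)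

(* Defs.v *)
From HB Require Import structures.
From mathcomp Require Import all_boot all_order all_algebra.
From mathcomp Require Import all_classical all_reals all_analysis.
Set Implicit Arguments.
Unset Strict Implicit.
Unset Printing Implicit Defensive.
Import Order.TTheory GRing.Theory Num.Theory.
Import numFieldNormedType.Exports.
Local Open Scope classical_set_scope.
Local Open Scope ring_scope.

(* [F] is of class C^k on the open set [D]: all iterated directional
   derivatives of order at most k exist and are continuous on [D]. *)
Fixpoint Ck (R : realType) (V : normedModType R) (k : nat)
    (D : set V) (F : V -> R) : Prop :=
  (forall x, D x -> {for x, continuous F}) /\
  match k with
  | 0 => True
  | k'.+1 => forall v : V,
      (forall x, D x -> derivable F x v) /\ Ck k' D ('D_v F)
  end.

Definition Gamma (R : realType) (p : R) : set (R * R) :=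
  [set l | (p - 2) * l.1 < l.2 /\ (p - 2) * l.2 < l.1].

Definition dotp (R : realType) (v w : 'rV[R]_3) : R := \sum_i v 0 i * w 0 i.

(* The Euclidean norm; the library norm on ['rV[R]_3] is the sup norm. *)
Definition enorm (R : realType) (v : 'rV[R]_3) : R := Num.sqrt (dotp v v).

Definition sphere (R : realType) : set 'rV[R]_3 := [set x | enorm x = 1].

Definition tangent (R : realType) (x : 'rV[R]_3) : set 'rV[R]_3 :=
  [set v | dotp x v = 0].

Definition tproj (R : realType) (x v : 'rV[R]_3) : 'rV[R]_3 :=
  v - dotp x v *: x.

Definition retract (R : realType) (y : 'rV[R]_3) : 'rV[R]_3 :=
  (enorm y)^-1 *: y.

(* A function (or vector field) on the sphere is a total map on ['rV[R]_3] of
   which only the values on the sphere matter: it is differentiated through its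
   extension [u \o retract], constant along rays, which is C^k off the origin
   exactly when the restriction of [u] to the sphere is C^k. *)
Definition Ck_sphere (R : realType) (k : nat) (u : 'rV[R]_3 -> R) : Prop :=
  Ck k [set y : 'rV[R]_3 | y != 0] (u \o @retract R).

Definition du (R : realType) (u : 'rV[R]_3 -> R) (x v : 'rV[R]_3) : R :=
  'D_v (u \o @retract R) x.

(* Tangent to the sphere at [x], because [du u x x = 0]. *)
Definition grad (R : realType) (u : 'rV[R]_3 -> R) (x : 'rV[R]_3) :
    'rV[R]_3 :=
  \row_i du u x (delta_mx 0 i).

(* Levi-Civita connection of the round metric (the one induced by the Euclidean
   metric): the tangential part of the Euclidean derivative of [Y] along [v],
   for [v] tangent at [x]. *)
Definition covd (R : realType) (Y : 'rV[R]_3 -> 'rV[R]_3) (x v : 'rV[R]_3) :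
    'rV[R]_3 :=
  tproj x ('D_v (Y \o @retract R) x).

Definition hess (R : realType) (u : 'rV[R]_3 -> R) (x v w : 'rV[R]_3) : R :=
  dotp (covd (grad u) x v) w.

(* |u|_{C^2} = sup |u| + sup |grad u| + sup |hess u|, where the norm of the
   bilinear form [hess u x] is its supremum over pairs of unit tangent vectors. *)
Definition C2norm (R : realType) (u : 'rV[R]_3 -> R) : \bar R :=
  let S0 : set R := [set `|u x| | x in @sphere R] in
  let S1 : set R := [set enorm (grad u x) | x in @sphere R] in
  let S2 : set R := [set r | exists x v w : 'rV[R]_3,
    [/\ sphere x, tangent x v /\ enorm v = 1, tangent x w /\ enorm w = 1
      & r = `|hess u x v w|]] in
  (ereal_sup (EFin @` S0) + ereal_sup (EFin @` S1)
   + ereal_sup (EFin @` S2))%E.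

(* The metric g_u = e^u g and the tensor A_{g_u}, as bilinear forms on the
   tangent plane at [x]; the last summand is K_g g with K_g = 1. *)
Definition gmetric (R : realType) (u : 'rV[R]_3 -> R) (x v w : 'rV[R]_3) : R :=
  expR (u x) * dotp v w.

Definition Atensor (R : realType) (u : 'rV[R]_3 -> R) (x v w : 'rV[R]_3) : R :=
  - hess u x v w + 2^-1 * (du u x v * du u x w)
  - 4^-1 * enorm (grad u x) ^+ 2 * dotp v w + 1 * dotp v w.

(* [l] lists, with multiplicity and in some order, the eigenvalues of
   g_u^{-1} A_{g_u} at [x]: this endomorphism has matrix [invmx G *m A] in the
   basis of the tangent plane formed by the rows of [E], and its characteristic
   polynomial does not depend on [E]. *)
Definition eigenvalues_gA (R : realType) (u : 'rV[R]_3 -> R) (x : 'rV[R]_3)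
    (l : R * R) : Prop :=
  exists E : 'M[R]_(2, 3),
    [/\ row_free E, forall i, tangent x (row i E)
      & let G := \matrix_(i < 2, j < 2) gmetric u x (row i E) (row j E) in
        let A := \matrix_(i < 2, j < 2) Atensor u x (row i E) (row j E) in
        char_poly (invmx G *m A) = ('X - l.1%:P) * ('X - l.2%:P)].

(* The Riemannian distance: the infimum of the lengths of C^1 curves on the
   sphere. Taking curves C^1 on the whole line loses nothing, since a C^1 curve
   on [0, 1] extends by great circles. *)
Definition sphere_dist (R : realType) (x y : 'rV[R]_3) : R :=
  inf [set L : R | exists c : R -> 'rV[R]_3,
    [/\ forall t, sphere (c t),
        (forall t, derivable c t 1) /\ continuous (derive1 c),
        c 0 = x, c 1 = y
      & L = \int[lebesgue_measure]_(t in `[0, 1]) enorm (derive1 c t)]].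

(* Main.v *)
Require Import Defs.
From HB Require Import structures.
From mathcomp Require Import all_boot all_order all_algebra.
From mathcomp Require Import all_classical all_reals all_analysis.
From mathcomp Require Import ring lra.
Set Implicit Arguments.
Unset Strict Implicit.
Unset Printing Implicit Defensive.
Import Order.TTheory GRing.Theory Num.Theory.
Import numFieldNormedType.Exports.
Local Open Scope classical_set_scope.
Local Open Scope ring_scope.

(** Write [w = e^(-u/2)].  The claim says that [w y] is at least a constant times
the distance from [y] to [x i], and [w] is minimal at [x i]; so it is enough to
show that [w] cannot be much smaller than the chord [d = |x - y|] at both of two
points [x] and [y] of the sphere, chord and distance being comparable
([sphere_dist_bounds]).  This holds for every solution, by two
applications of the maximum principle, with explicit barriers.

In terms of [w], multiplying A_{g_u} by [w^2] gives
[2 w Hess w - |grad w|^2 g + w^2 g], and the eigenvalues of g_u^{-1} A_{g_u} are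
those of this form with respect to [g].  If [w / W] has its maximum, with
value [t], at a point [z] where [W] is smooth, then [w] and [t W] agree to first
order at [z] and [Hess w <= t Hess W], so the form of [w] is at most that of
[t W].

The first barrier uses only that the eigenvalues lie in the cone.  Put
[S = 1 - z.x], [T = 1 - z.y] and [b = (p - 1) / 2].  The function
[W = (S^b + T^b)^(1/b)] is the Moebius image of [(1 + r^(2b))^(1/b)]; its form
has, in the direction of the gradient of [ln (S / T)], the eigenvalue [p - 2]
times the other one, so it lies on the boundary of [Gamma p].  Hence [w / W] has
no maximum away from the poles [x] and [y]
([two_pole_touching]), and [w] is controlled on the whole sphere by its values
at the two poles ([two_pole_bound]).  This is where [p > 1] enters: the constant
[2^(1/b)] in this control blows up as [b] tends to 0.  If [w] is at most a small
multiple of [d] at both poles, the result is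
[w z <= a d^(-1) (d^2 + |z - x|^2)] everywhere, with [a] small.

The second barrier uses the lower bound on the trace, which follows from
[K >= c1] and the concavity, symmetry and homogeneity of [f]
([trace_lower_bound]).  The bubbles [W_s = s^2 + |z - x|^2] have constant
curvature, and at a maximum of [w / W_s] the trace bound gives a lower bound for
the ratio ([bubble_touching]).  So [w <= (a / s) W_s] with [a] small
self-improves: it persists when [s] is halved ([bubble_halving]).  Letting [s]
tend to zero forces [w x = 0], which is absurd ([no_bubble_above]).

Everything is computed along lines.  The extension [u \o retract] is constant on
rays, so its restriction to the tangent line [t v + z] is [u] along a
reparametrised great circle, with the same first two derivatives at [t = 0]. *)

(** * Directional calculus for functions of class C^k *)

Lemma is_derive_line (R : realType) (V : normedModType R) (F : V -> R)
    (z v : V) (t : R) :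
  derivable F (t *: v + z) v ->
  is_derive t 1 (fun s => F (s *: v + z)) ('D_v F (t *: v + z)).
Proof.
have E : (fun h : R => h^-1 *: ((F \o shift (t *: v + z)) (h *: v) - F (t *: v + z)))
   = (fun h : R => h^-1 *: (((fun s => F (s *: v + z)) \o shift t) (h *: (1 : R))
                     - F (t *: v + z))).
  by apply/funext => h /=; rewrite addrA -scalerDl /GRing.scale /= mulr1.
move=> dF; apply: DeriveDef; first by rewrite /derivable -E.
by rewrite /derive -E.
Qed.

(** The mean value theorem from the origin, in a form that does not depend on
    the sign of [h]. *)
Lemma mvt_at0 (R : realType) (F dF : R -> R) (h : R) :
  (forall t : R, `|t| <= `|h| -> is_derive t 1 F (dF t)) ->
  exists2 c, `|c| <= `|h| & F h - F 0 = dF c * h.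
Proof.
move=> dFP.
have cF : forall t, `|t| <= `|h| -> {for t, continuous F}.
  move=> t /dFP[dt _].
  exact/differentiable_continuous/derivable1_diffP.
have sub a b : `|a| <= `|h| -> `|b| <= `|h| -> forall t, t \in `[a, b]%R -> `|t| <= `|h|.
  move=> ah bh t; rewrite in_itv /= => /andP[at_ tb].
  move: ah bh; rewrite !ler_norml => /andP[a1 a2] /andP[b1 b2].
  by rewrite (le_trans a1 at_) (le_trans tb b2).
have key a b : `|a| <= `|h| -> `|b| <= `|h| -> a <= b ->
    exists2 c, c \in `[a, b]%R & F b - F a = dF c * (b - a).
  move=> ah bh ab; apply: MVT_segment => //.
    by move=> t /subset_itv_oo_cc /(sub _ _ ah bh); exact: dFP.
  apply/continuous_in_subspaceT => t; rewrite inE /= => /(sub _ _ ah bh).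
  exact: cF.
have h0 : `|0 : R| <= `|h| by rewrite normr0.
case: (leP 0 h) => [hge|/ltW hle].
  have [c cI e] := key 0 h h0 (lexx _) hge.
  by exists c; [exact: (sub _ _ h0 (lexx _) _ cI)|rewrite e subr0].
have [c cI e] := key h 0 (lexx _) h0 hle.
exists c; first exact: (sub _ _ (lexx _) h0 _ cI).
by rewrite -opprB e sub0r mulrN opprK.
Qed.

(** Both the linearity of the derivative in the direction and the symmetry of
    second derivatives come from the mean value theorem on a small
    parallelogram; this provides one inside a given neighbourhood. *)
Lemma near_parallelogram (R : realType) (V : normedModType R) (x v w : V)
    (P : set V) : nbhs x P ->
  exists2 d : R, 0 < d &
    forall s t, `|s| < d -> `|t| < d -> P (s *: v + t *: w + x).
Proof.
move=> /nbhs_ballP[e /= e0 Pe].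
have N0 : 0 < `|v| + `|w| + 1 by rewrite ltr_wpDl // addr_ge0.
exists (e / (`|v| + `|w| + 1)); first exact: divr_gt0.
move=> s t sd td; apply: Pe; rewrite -ball_normE /ball_ /=.
rewrite opprD addrCA subrr addr0 normrN.
apply: (le_lt_trans (ler_normD _ _)); rewrite !normrZ.
apply: (@le_lt_trans _ _ (e / (`|v| + `|w| + 1) * (`|v| + `|w|))).
  by rewrite mulrDr lerD // ler_wpM2r // ltW.
rewrite mulrAC ltr_pdivrMr // ltr_pM2l // ltrDl; exact: ltr01.
Qed.

(** Directional differentiability does not give linearity in the direction;
    continuity of ['D_w F] does.  Split the increment along [v + w] through the
    corner [h v + x]: the second piece is ['D_w F] at a nearby point, by the
    mean value theorem. *)
Lemma is_deriveDdir (R : realType) (V : normedModType R) (F : V -> R)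
    (x v w : V) :
  derivable F x v -> (\forall y \near x, derivable F y w) ->
  {for x, continuous ('D_w F)} ->
  is_derive x (v + w) F ('D_v F x + 'D_w F x).
Proof.
move=> dv dw cw.
suff H : (fun h : R => h^-1 *: ((F \o shift x) (h *: (v + w)) - F x)) @ 0^' -->
    'D_v F x + 'D_w F x.
  by apply: DeriveDef; [apply/cvg_ex; eexists; exact: H | exact: cvg_lim H].
have -> : (fun h : R => h^-1 *: ((F \o shift x) (h *: (v + w)) - F x)) =
    (fun h => h^-1 *: ((F \o shift x) (h *: v) - F x)
      + h^-1 *: (F (h *: v + h *: w + x) - F (h *: v + x))).
  apply/funext => h /=; rewrite -scalerDr [h *: (v + w)]scalerDr; congr (_ *: _).
  by rewrite [RHS]addrC addrA subrK.
apply: cvgD; first exact: dv.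
apply/cvgrPdist_lt => e e0.
have near1 : \forall y \near x, `|'D_w F x - 'D_w F y| < e.
  by move/cvgrPdist_lt : cw => /(_ e e0).
have [d d0 H] := near_parallelogram v w (filterI dw near1).
near=> h.
have hd : `|h| < d by near: h; exact: dnbhs0_lt.
have hn : h != 0 by near: h; exact: nbhs_dnbhs_neq.
have := @mvt_at0 R (fun t => F (t *: w + (h *: v + x)))
  (fun t => 'D_w F (t *: w + (h *: v + x))) h.
case.
  move=> t th; apply: is_derive_line.
  by rewrite addrCA addrA; have [] := H h t hd (le_lt_trans th hd).
move=> c ch /= eq1.
have -> : h *: v + h *: w + x = h *: w + (h *: v + x) by rewrite addrCA addrA.
rewrite scale0r add0r in eq1; rewrite eq1 /GRing.scale /= mulrC mulfK //.
by rewrite addrCA addrA; have [] := H h c hd (le_lt_trans ch hd).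
Unshelve. all: by end_near.
Qed.

Lemma is_derive_from_line (R : realType) (V : normedModType R) (F : V -> R)
    (x v : V) (d : R) :
  is_derive (0 : R) 1 (fun s : R => F (s *: v + x)) d -> is_derive x v F d.
Proof.
have E : (fun h : R => h^-1 *: ((F \o shift x) (h *: v) - F x))
   = (fun h : R => h^-1 *: (((fun s => F (s *: v + x)) \o shift 0) (h *: (1 : R))
                     - (fun s => F (s *: v + x)) 0)).
  by apply/funext => h /=; rewrite addr0 scale0r add0r [h *: (1 : R)]mulr1.
case=> H2 H3; apply: DeriveDef; first by rewrite /derivable E.
by rewrite /derive E.
Qed.

Lemma is_deriveZdir (R : realType) (V : normedModType R) (F : V -> R)
    (x v : V) (c : R) :
  derivable F x v -> is_derive x (c *: v) F (c * 'D_v F x).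
Proof.
move=> dv.
have H : is_derive (0 : R) 1 (fun s : R => F (s *: v + x)) ('D_v F x).
  have := @is_derive_line R V F x v 0; rewrite scale0r add0r.
  by apply.
have H2 : is_derive (0 : R) 1 (fun s : R => F (s *: (c *: v) + x)) (c * 'D_v F x).
  have -> : (fun s : R => F (s *: (c *: v) + x)) =
            (fun s : R => F (s *: v + x)) \o (fun s => s * c).
    by apply/funext => s /=; rewrite scalerA.
  have dm : is_derive (0 : R) 1 (fun s : R => s * c) c.
    have -> : (fun s : R => s * c) = (c *: (id : R -> R)).
      by apply/funext => s /=; rewrite mulrC.
    by apply: is_derive_eq; rewrite /GRing.scale /= mulr1.
  have H' : is_derive ((fun s : R => s * c) 0) 1 (fun s : R => F (s *: v + x)) ('D_v F x).
    by rewrite mul0r.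
  rewrite mulrC; exact: (@is_derive1_comp R (fun s : R => F (s *: v + x))
    (fun s : R => s * c) 0 _ _ H' dm).
exact: (@is_derive_from_line R V F x (c *: v) _ H2).
Qed.

Section Ck_theory.
Context {R : realType} {V : normedModType R}.
Implicit Types (D : set V) (F : V -> R) (x v w : V).

Lemma Ck_continuous k D F x : Ck k D F -> D x -> {for x, continuous F}.
Proof. by case: k => [|k] [cF _]; exact: cF. Qed.

Lemma Ck_derivable k D F x v : Ck k.+1 D F -> D x -> derivable F x v.
Proof. by move=> [_ /(_ v)[dF _]]; exact: dF. Qed.

Lemma Ck_derive k D F v : Ck k.+1 D F -> Ck k D ('D_v F).
Proof. by move=> [_ /(_ v)[]]. Qed.

Lemma Ck_deriveD k D F x v w : open D -> Ck k.+1 D F -> D x ->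
  'D_(v + w) F x = 'D_v F x + 'D_w F x.
Proof.
move=> oD CF Dx; apply: derive_val; apply: is_deriveDdir.
- exact: Ck_derivable CF Dx.
- apply: filterS (open_nbhs_nbhs (conj oD Dx)) => y Dy.
  exact: Ck_derivable CF Dy.
- exact: Ck_continuous (Ck_derive w CF) Dx.
Qed.

Lemma Ck_deriveZ k D F x v c : Ck k.+1 D F -> D x ->
  'D_(c *: v) F x = c * 'D_v F x.
Proof.
by move=> CF Dx; apply: derive_val; apply: is_deriveZdir; exact: Ck_derivable CF Dx.
Qed.

Let diff2_cvg D F x v w : open D -> Ck 2 D F -> D x ->
  (F (h *: v + h *: w + x) - F (h *: v + x) - F (h *: w + x) + F x) / h ^+ 2
    @[h --> 0^'] --> 'D_w ('D_v F) x.
Proof.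
move=> oD CF Dx; apply/cvgrPdist_lt => e e0.
have nD : nbhs x D by exact: open_nbhs_nbhs.
have near1 : \forall y \near x, `|'D_w ('D_v F) x - 'D_w ('D_v F) y| < e.
  have := Ck_continuous (Ck_derive w (Ck_derive v CF)) Dx.
  by move/cvgrPdist_lt => /(_ e e0).
have [d d0 H] := near_parallelogram v w (filterI nD near1).
near=> h.
have hd : `|h| < d by near: h; exact: dnbhs0_lt.
have hn : h != 0 by near: h; exact: nbhs_dnbhs_neq.
have lev (t : R) : `|t| <= `|h| -> D (t *: v + x).
  move=> th; have [] := H t 0 (le_lt_trans th hd) _; rewrite ?normr0 //.
  by rewrite scale0r addr0.
have levw (t s : R) : `|t| <= `|h| -> `|s| <= `|h| ->
    (D `&` (fun y => `|'D_w ('D_v F) x - 'D_w ('D_v F) y| < e))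
      (t *: v + s *: w + x).
  move=> th sh.
  exact: H (le_lt_trans th hd) (le_lt_trans sh hd).
have dphi (t : R) : `|t| <= `|h| -> is_derive t 1
    (fun t => F (t *: v + (h *: w + x)) - F (t *: v + x))
    ('D_v F (t *: v + (h *: w + x)) - 'D_v F (t *: v + x)).
  move=> th; apply: is_deriveB; apply: is_derive_line.
    apply: (Ck_derivable CF).
    by rewrite addrA; have [] := levw t h th (lexx _).
  apply: (Ck_derivable CF); exact: lev.
have [t th et] := mvt_at0 dphi.
have dpsi (s : R) : `|s| <= `|h| -> is_derive s 1
    (fun s => 'D_v F (s *: w + (t *: v + x)))
    ('D_w ('D_v F) (s *: w + (t *: v + x))).
  move=> sh; apply: is_derive_line; apply: (Ck_derivable (Ck_derive v CF)).
  by rewrite addrCA addrA; have [] := levw t s th sh.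
have [s sh es] := mvt_at0 dpsi.
have -> : F (h *: v + h *: w + x) - F (h *: v + x) - F (h *: w + x) + F x
    = 'D_w ('D_v F) (t *: v + s *: w + x) * h ^+ 2.
  move: et es; rewrite !scale0r !add0r.
  rewrite !(addrCA (h *: w)) (addrCA (s *: w)) !addrA => et es.
  rewrite es in et; rewrite expr2 mulrA -et; ring.
by rewrite mulfK ?expf_neq0 //; have [] := levw t s th sh.
Unshelve. all: by end_near.
Qed.

(** Schwarz's theorem: the second difference over a parallelogram is symmetric
    in [v] and [w], and two applications of the mean value theorem, in either
    order, show that it converges to either mixed derivative. *)
Lemma Ck_deriveC D F x v w : open D -> Ck 2 D F -> D x ->
  'D_w ('D_v F) x = 'D_v ('D_w F) x.
Proof.
move=> oD CF Dx; have H1 := @diff2_cvg D F x v w oD CF Dx.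
have H2 := @diff2_cvg D F x w v oD CF Dx.
rewrite -(cvg_lim (@Rhausdorff R) H1) -(cvg_lim (@Rhausdorff R) H2).
congr (lim (_ @ 0^')); apply/funext => h.
by rewrite (addrC (h *: v)) [in LHS](addrAC _ (- F (h *: v + x))).
Qed.

End Ck_theory.

(** * Second-order calculus on the line *)

Section second_order.
Context {R : realType}.
Implicit Types (F f g : R -> R) (t a b : R).

Lemma second_derivative_test (F F1 : R -> R) (a : R) :
  (forall t : R, is_derive t 1 F (F1 t)) -> is_derive (0 : R) 1 F1 a ->
  (forall t, F 0 <= F t) -> F1 0 = 0 /\ 0 <= a.
Proof.
move=> dF dF1 minF.
have F10 : F1 0 = 0.
  have I0 : (0 : R) \in `]-1, 1[%R by rewrite in_itv /= ltrN10 ltr01.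
  have N11 : (-1 : R) <= 1 by lra.
  have [_ <-] := dF 0.
  have [_ ->] := derive1_at_min N11 (fun t _ => let: DeriveDef e _ := dF t in e)
    I0 (fun t _ => minF t).
  by [].
split => //; rewrite leNgt; apply/negP => a0.
case: dF1 => dF1 aE.
have : (fun h : R => h^-1 *: ((F1 \o shift 0) (h *: 1) - F1 0)) @ 0^' --> a.
  by rewrite -aE; exact: dF1.
move=> /cvgr_lt /(_ 0 a0); rewrite /dnbhs /within /= => /nbhs_ballP[e /= e0 eP].
have e2 : 0 < e / 2 by rewrite divr_gt0.
have neg c : c \in `]0, (e / 2)[%R -> F1 c < 0.
  rewrite in_itv /= => /andP[c0 ce].
  have := eP c; rewrite -ball_normE /ball_ /= sub0r normrN gtr0_norm //.
  have ce' : c < e by lra.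
  move=> /(_ ce' (lt0r_neq0 c0)).
  rewrite addr0 F10 subr0 [c *: 1]mulr1 /GRing.scale /= => H.
  by rewrite -(pmulr_rlt0 _ (_ : 0 < c^-1)) // invr_gt0.
have [c cI] := MVT e2 (fun x _ => dF x)
  (@continuous_subspaceT _ _ _ _ (fun x => differentiable_continuous
     ((derivable1_diffP _ _).1 (let: DeriveDef e _ := dF x in e)))).
move=> E; have := minF (e / 2); rewrite -subr_ge0 E subr0 leNgt.
by rewrite nmulr_rlt0 ?e2 // neg.
Qed.

Lemma is_derive_lnf f (x d : R) : 0 < f x -> is_derive x 1 f d ->
  is_derive x 1 (fun t => ln (f t)) (d / f x).
Proof.
move=> f0 df; rewrite mulrC.
exact: (@is_derive1_comp R (@ln R) f x _ _ (is_derive1_ln f0) df).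
Qed.

Lemma is_derive_expf f (x d : R) : is_derive x 1 f d ->
  is_derive x 1 (fun t => expR (f t)) (expR (f x) * d).
Proof.
move=> df.
exact: (@is_derive1_comp R (@expR R) f x _ _ (is_derive_expR (f x)) df).
Qed.

Lemma is_derive_scale f (k x d : R) : is_derive x 1 f d ->
  is_derive x 1 (fun t => k * f t) (k * d).
Proof. by move=> df; exact: (@is_deriveZ R R R f k x 1 d df). Qed.

Lemma is_derive_mulf f g (x d e : R) : is_derive x 1 f d -> is_derive x 1 g e ->
  is_derive x 1 (fun t => f t * g t) (f x * e + g x * d).
Proof. by move=> df dg; exact: (@is_deriveM R R f g x 1 d e df dg). Qed.

Lemma is_derive_divf f g (x d e : R) : g x != 0 ->
  is_derive x 1 f d -> is_derive x 1 g e ->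
  is_derive x 1 (fun t => f t / g t) ((d * g x - f x * e) / g x ^+ 2).
Proof.
move=> g0 df dg; have dV := is_deriveV g0 dg.
apply: (is_derive_eq (@is_derive_mulf f (fun y => (g y)^-1) x _ _ df dV)).
rewrite /GRing.scale /=; field; exact: g0.
Qed.

Lemma is_derive_quadratic (a b c x : R) :
  is_derive x 1 (fun t => a + b * t + c * t ^+ 2) (b + 2 * c * x).
Proof.
have H1 : is_derive x 1 (fun t : R => b * t) (b * 1) by exact: is_derive_scale.
have H2 : is_derive x 1 (fun t : R => t ^+ 2) (x * 1 + x * 1).
  exact: (@is_derive_mulf id id x 1 1 (is_derive_id x 1) (is_derive_id x 1)).
have H := is_deriveD (is_deriveD (is_derive_cst a x 1) H1) (is_derive_scale c H2).
apply: (is_derive_eq H); ring.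
Qed.

Lemma is_derive_affine (a b x : R) :
  is_derive x 1 (fun t => a + b * t) b.
Proof.
have H1 : is_derive x 1 (fun t : R => b * t) (b * 1) by exact: is_derive_scale.
by have := is_deriveD (is_derive_cst a x 1) H1; rewrite add0r mulr1.
Qed.


(** The barriers are built from logarithms of quadratics, because along a
    tangent line [1 - y.x] is bounded by a quadratic; see
    [great_circle_quadratic]. *)
Lemma second_order_log (A B C : R) :
  (forall t, 0 < A + B * t + C * t ^+ 2) ->
  let q t := A + B * t + C * t ^+ 2 in
  (forall t, is_derive t 1 (fun t => ln (q t)) ((B + 2 * C * t) / q t)) /\
  is_derive (0 : R) 1 (fun t => (B + 2 * C * t) / q t) (2 * C / A - (B / A) ^+ 2).
Proof.
move=> q0 q; split=> [t|].
  exact: (@is_derive_lnf q t _ (q0 t) (is_derive_quadratic A B C t)).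
have A0 : A != 0.
  have := q0 0; rewrite mulr0 addr0 expr0n /= mulr0 addr0.
  exact: lt0r_neq0.
apply: (is_derive_eq (@is_derive_divf (fun t => B + 2 * C * t) q 0 _ _
  (lt0r_neq0 (q0 0)) (is_derive_affine B (2 * C) 0)
  (is_derive_quadratic A B C 0))).
by rewrite /q; field.
Qed.

(** The jet of the logarithm of [(e^(b l) + e^(b m))^(1/b)].  [P] and [Q] are
    the weights of the two terms, and the last term of the second derivative is
    [b] times the variance of the slopes. *)
Lemma second_order_logsum (b : R) (l m l1 m1 : R -> R) (l2 m2 : R) : b != 0 ->
  (forall t, is_derive t 1 l (l1 t)) -> (forall t, is_derive t 1 m (m1 t)) ->
  is_derive (0 : R) 1 l1 l2 -> is_derive (0 : R) 1 m1 m2 ->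
  let P := expR (b * l 0) / (expR (b * l 0) + expR (b * m 0)) in
  let Q := expR (b * m 0) / (expR (b * l 0) + expR (b * m 0)) in
  exists G1 : R -> R, [/\
    forall t, is_derive t 1
      (fun t => b^-1 * ln (expR (b * l t) + expR (b * m t))) (G1 t),
    G1 0 = P * l1 0 + Q * m1 0 &
    is_derive (0 : R) 1 G1
      (P * l2 + Q * m2 + b * P * Q * (l1 0 - m1 0) ^+ 2)].
Proof.
move=> b0 dl dm dl1 dm1 P Q.
pose E1 t := expR (b * l t); pose E2 t := expR (b * m t).
have dE1 t : is_derive t 1 E1 (E1 t * (b * l1 t)).
  by apply: (@is_derive_expf (fun t => b * l t)); exact: is_derive_scale.
have dE2 t : is_derive t 1 E2 (E2 t * (b * m1 t)).
  by apply: (@is_derive_expf (fun t => b * m t)); exact: is_derive_scale.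
have S0 t : 0 < E1 t + E2 t by rewrite addr_gt0 // expR_gt0.
have dS t : is_derive t 1 (fun t => E1 t + E2 t)
   (E1 t * (b * l1 t) + E2 t * (b * m1 t)) by exact: is_deriveD.
exists (fun t => (E1 t * l1 t + E2 t * m1 t) / (E1 t + E2 t)); split.
- move=> t; apply: (is_derive_eq (@is_derive_scale
    (fun t => ln (E1 t + E2 t)) b^-1 t _
    (@is_derive_lnf (fun t => E1 t + E2 t) t _ (S0 t) (dS t)))).
  by field; rewrite b0 lt0r_neq0.
- by rewrite /P /Q -/(E1 0) -/(E2 0); field; rewrite lt0r_neq0.
have dN : is_derive (0 : R) 1 (fun t => E1 t * l1 t + E2 t * m1 t)
   ((E1 0 * l2 + l1 0 * (E1 0 * (b * l1 0)))
    + (E2 0 * m2 + m1 0 * (E2 0 * (b * m1 0)))).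
  by apply: is_deriveD; exact: is_derive_mulf.
apply: (is_derive_eq (@is_derive_divf (fun t => E1 t * l1 t + E2 t * m1 t)
  (fun t => E1 t + E2 t) 0 _ _ (lt0r_neq0 (S0 0)) dN (dS 0))).
by rewrite /P /Q -/(E1 0) -/(E2 0); field; rewrite lt0r_neq0.
Qed.

End second_order.

(** * Functions on the sphere through their radial extension *)

Section sphere_geometry.
Context {R : realType}.
Implicit Types (u : 'rV[R]_3 -> R) (x y z v w : 'rV[R]_3).

Lemma dotpC v w : dotp v w = dotp w v.
Proof. by apply: eq_bigr => i _; rewrite mulrC. Qed.

Lemma dotpDl x y z : dotp (x + y) z = dotp x z + dotp y z.
Proof. by rewrite -big_split /=; apply: eq_bigr => i _; rewrite mxE mulrDl. Qed.

Lemma dotpZl (c : R) x y : dotp (c *: x) y = c * dotp x y.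
Proof. by rewrite mulr_sumr; apply: eq_bigr => i _; rewrite mxE mulrA. Qed.

Lemma dotpNl x y : dotp (- x) y = - dotp x y.
Proof. by rewrite -scaleN1r dotpZl mulN1r. Qed.

Lemma dotpDr x y z : dotp x (y + z) = dotp x y + dotp x z.
Proof. by rewrite dotpC dotpDl !(dotpC x). Qed.

Lemma dotpZr (c : R) x y : dotp x (c *: y) = c * dotp x y.
Proof. by rewrite dotpC dotpZl dotpC. Qed.

Lemma dotpNr x y : dotp x (- y) = - dotp x y.
Proof. by rewrite dotpC dotpNl dotpC. Qed.

Lemma dotp_ge0 x : 0 <= dotp x x.
Proof. by apply: sumr_ge0 => i _; rewrite -expr2 sqr_ge0. Qed.

Lemma dotp_eq0 x : (dotp x x == 0) = (x == 0).
Proof.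
apply/eqP/eqP => [|->]; last by rewrite -(scale0r 0) dotpZl mul0r.
move=> /psumr_eq0P H; apply/rowP => i; rewrite mxE.
have /eqP := H (fun i _ => sqr_ge0 (x 0 i)) i isT.
by rewrite mulf_eq0 orbb => /eqP.
Qed.

Lemma dotp_gt0 x : (0 < dotp x x) = (x != 0).
Proof. by rewrite lt_def dotp_ge0 andbT dotp_eq0. Qed.

Lemma enormZ (c : R) x : 0 <= c -> enorm (c *: x) = c * enorm x.
Proof.
move=> c0; rewrite /enorm dotpZl dotpZr mulrA -expr2 sqrtrM ?sqr_ge0 //.
by rewrite sqrtr_sqr ger0_norm.
Qed.

Lemma enorm_gt0 x : (0 < enorm x) = (x != 0).
Proof. by rewrite /enorm sqrtr_gt0 dotp_gt0. Qed.

Lemma sqr_enorm x : enorm x ^+ 2 = dotp x x.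
Proof. by rewrite sqr_sqrtr // dotp_ge0. Qed.

Lemma sphereE x : sphere x <-> dotp x x = 1.
Proof.
rewrite /sphere /= -sqr_enorm; split=> [->|/eqP]; first by rewrite expr1n.
rewrite sqrf_eq1 => /orP[/eqP //|/eqP E].
by have := sqrtr_ge0 (dotp x x); rewrite -/(enorm x) E ler0N1.
Qed.

Lemma sphere_neq0 x : sphere x -> x != 0.
Proof. by move=> /sphereE xx; rewrite -dotp_gt0 xx. Qed.

Lemma retract_sphere x : sphere x -> retract x = x.
Proof. by move=> Sx; rewrite /retract Sx invr1 scale1r. Qed.

Lemma sphere_retract x : x != 0 -> sphere (retract x).
Proof.
move=> x0; rewrite /sphere /= /retract enormZ ?invr_ge0 ?sqrtr_ge0 //.
by rewrite mulVf // gt_eqF // enorm_gt0.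
Qed.

Lemma retractZ (c : R) x : 0 < c -> retract (c *: x) = retract x.
Proof.
move=> c0; rewrite /retract enormZ ?ltW // scalerA invfM -mulrA mulrCA.
by rewrite mulVf ?mulr1 // gt_eqF.
Qed.

Lemma open_neq0 : open [set y : 'rV[R]_3 | y != 0].
Proof.
have -> : [set y : 'rV[R]_3 | y != 0] = ~` [set 0].
  by apply/seteqP; split=> y /= /eqP.
apply/closed_openC/accessible_closed_set1/hausdorff_accessible.
exact: norm_hausdorff.
Qed.

(** The derivative of a function homogeneous of degree 0 is homogeneous of
    degree -1. *)
Lemma derive_retractZ u (c : R) y v : 0 < c -> Ck_sphere 1 u -> y != 0 ->
  'D_v (u \o @retract R) (c *: y) = c^-1 * 'D_v (u \o @retract R) y.
Proof.
rewrite /Ck_sphere => c0 Cu y0; rewrite -(Ck_deriveZ v c^-1 Cu y0) /derive.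
congr (lim (_ @ 0^')); apply/funext => h /=; congr (_ *: (_ - _)); last first.
  by rewrite retractZ.
congr u; rewrite -[RHS](retractZ _ c0); congr retract.
by rewrite scalerDr !scalerA mulrAC divff ?mul1r // gt_eqF.
Qed.

Lemma derive_radial u z :
  derivable (u \o @retract R) z z -> 'D_z (u \o @retract R) z = 0.
Proof.
move=> dz.
have := @is_derive_line R _ (u \o @retract R) z z 0.
rewrite scale0r add0r => /(_ dz) [_ <-].
transitivity ('D_1 (cst (u (retract z)) : R -> R) (0 : R)); last by rewrite derive_cst.
apply: near_eq_derive; apply: filterS (nbhs0_lt ltr01) => s s1.
rewrite /= -{2}(scale1r z) -scalerDl retractZ //.
by move: s1; rewrite ltr_norml; lra.
Qed.

Lemma tangent_line_neq0 z v (t : R) : sphere z -> tangent z v -> t *: v + z != 0.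
Proof.
move=> /sphereE zz zv; rewrite -dotp_gt0 dotpDl !dotpDr !dotpZl !dotpZr zz.
rewrite (dotpC v z) zv !mulr0 addr0 add0r ltr_pwDr // mulrA -expr2.
by rewrite mulr_ge0 ?sqr_ge0 ?dotp_ge0.
Qed.

Lemma is_derive_enorm_tangent z v : sphere z -> tangent z v ->
  is_derive z v (@enorm R) 0.
Proof.
move=> Sz zv; apply: is_derive_from_line.
have E : (fun s : R => enorm (s *: v + z)) =
    Num.sqrt \o (fun s : R => 1 + 0 * s + dotp v v * s ^+ 2).
  apply/funext => s /=; congr Num.sqrt; move/sphereE: Sz => zz.
  rewrite dotpDl !dotpDr !dotpZl !dotpZr zz (dotpC v z) zv; ring.
rewrite E.
have H1 := is_derive_quadratic 1 0 (dotp v v) 0.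
have H2 : is_derive ((fun s : R => 1 + 0 * s + dotp v v * s ^+ 2) 0) 1
   Num.sqrt (2 * Num.sqrt 1)^-1.
  rewrite /= mul0r expr0n /= mulr0 !addr0; exact: is_derive1_sqrt.
have := @is_derive1_comp R _ (fun s : R => 1 + 0 * s + dotp v v * s ^+ 2) 0 _ _ H2 H1.
by rewrite mulr0 add0r mulr0.
Qed.

Lemma du_radial u z : Ck_sphere 1 u -> sphere z -> du u z z = 0.
Proof.
rewrite /Ck_sphere => Cu Sz; apply: derive_radial; exact: Ck_derivable Cu (sphere_neq0 Sz).
Qed.

Lemma row_delta_sum v : v = \sum_i v 0 i *: delta_mx 0 i.
Proof.
apply/rowP => j; rewrite summxE (bigD1 j) //= big1 => [|i ij].
  by rewrite !mxE !eqxx mulr1 addr0.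
by rewrite !mxE (eq_sym j) (negbTE ij) andbF mulr0.
Qed.

Lemma Ck_derive_sum k (D : set 'rV[R]_3) (F : 'rV[R]_3 -> R) x v :
  open D -> Ck k.+1 D F -> D x ->
  'D_v F x = \sum_i v 0 i * 'D_(delta_mx 0 i) F x.
Proof.
move=> oD CF Dx; rewrite [in LHS](row_delta_sum v) !big_ord_recl !big_ord0 !addr0.
by rewrite !(Ck_deriveD _ _ oD CF Dx) !(Ck_deriveZ _ _ CF Dx).
Qed.

Lemma du_grad u z v : Ck_sphere 1 u -> sphere z -> du u z v = dotp v (grad u z).
Proof.
rewrite /Ck_sphere => Cu Sz; rewrite /du (Ck_derive_sum v open_neq0 Cu (sphere_neq0 Sz)).
by apply: eq_bigr => i _; rewrite mxE.
Qed.

(** The gradient of the radial extension is homogeneous of degree -1, so its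
    value at [retract y] is [enorm y] times its value at [y]; the factor has
    zero derivative in tangent directions.  Thus the covariant Hessian is the
    flat one of the extension on tangent vectors. *)
Lemma hess_derive u z v w : Ck_sphere 2 u -> sphere z -> tangent z v ->
  tangent z w ->
  hess u z v w = 'D_v ('D_w (u \o @retract R)) z.
Proof.
rewrite /Ck_sphere => Cu Sz zv zw; set U := u \o @retract R.
have C1u : Ck 1 [set y | y != 0] U.
  by split; [case: Cu|move=> d; case: Cu => _ /(_ d)[? [? _]]; split].
have z0 := sphere_neq0 Sz.
have dE (i : 'I_3) : is_derive z v (fun y => (grad u (retract y)) 0 i)
    ('D_v ('D_(delta_mx 0 i) U) z).
  apply: (@near_eq_is_derive R _ _ (fun y => enorm y * 'D_(delta_mx 0 i) U y)).
    apply: filterS (open_nbhs_nbhs (conj open_neq0 z0)) => y y0.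
    rewrite mxE /du derive_retractZ // ?invr_gt0 ?enorm_gt0 //.
    by rewrite invrK.
  have D1 := is_derive_enorm_tangent Sz zv.
  have D2 : is_derive z v ('D_(delta_mx 0 i) U) ('D_v ('D_(delta_mx 0 i) U) z).
    by apply: derivableP; exact: Ck_derivable (Ck_derive _ Cu) z0.
  apply: (is_derive_eq (@is_deriveM R _ (@enorm R) ('D_(delta_mx 0 i) U) z v _ _ D1 D2)).
  by rewrite Sz scaler0 addr0 scale1r.
have dG : derivable (grad u \o @retract R) z v.
  by apply/derivable_mxP => i j; rewrite ord1; case: (dE j).
rewrite /hess /covd /tproj dotpDl dotpNl dotpZl zw mulr0 subr0 derive_mx //.
transitivity ('D_v (\sum_i (w 0 i *: 'D_(delta_mx 0 i) U)) z); last first.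
  apply: near_eq_derive.
  apply: filterS (open_nbhs_nbhs (conj open_neq0 z0)) => y y0.
  rewrite (Ck_derive_sum w open_neq0 C1u y0).
  by rewrite fct_sumE; apply: eq_bigr.
rewrite derive_sum; last first.
  by move=> i; apply: derivableZ; exact: Ck_derivable (Ck_derive _ Cu) z0.
apply: eq_bigr => i _; rewrite mxE deriveZ; last exact: Ck_derivable (Ck_derive _ Cu) z0.
by have [_ ->] := dE i; rewrite mulrC.
Qed.

End sphere_geometry.

(** * Orthonormal frames *)

Section frames.
Context {R : realType}.
Implicit Types (u : 'rV[R]_3 -> R) (x y z v w : 'rV[R]_3).

Definition orthoframe z e1 e2 : Prop :=
  [/\ dotp z z = 1, dotp e1 e1 = 1, dotp e2 e2 = 1 &
   [/\ dotp z e1 = 0, dotp z e2 = 0 & dotp e1 e2 = 0]].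

Lemma mul_tr_dotp v w : v *m w^T = (dotp v w)%:M.
Proof.
apply/matrixP => i j; rewrite !ord1 !mxE eqxx mulr1n.
by apply: eq_bigr => k _; rewrite mxE.
Qed.

(** A right inverse of a square matrix is a left inverse. *)
Lemma orthoframe_decomp z e1 e2 v : orthoframe z e1 e2 ->
  v = dotp v z *: z + dotp v e1 *: e1 + dotp v e2 *: e2.
Proof.
move=> [zz e11 e22 [z1 z2 e12]].
pose M : 'M[R]_(1 + (1 + 1), 3) := col_mx z (col_mx e1 e2).
pose N : 'M[R]_(3, 1 + (1 + 1)) := row_mx z^T (row_mx e1^T e2^T).
have MN : M *m N = 1%:M.
  rewrite /M /N mul_col_row mul_col_row !mul_mx_row !mul_col_mx !mul_tr_dotp.
  rewrite (dotpC e1 z) (dotpC e2 z) (dotpC e2 e1) zz e11 e22 z1 z2 e12.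
  by rewrite !raddf0 row_mx0 col_mx0 -!scalar_mx_block.
have NM : N *m M = 1%:M := @mulmx1C R 3 M N MN.
rewrite -[LHS]mulmx1 -NM mulmxA /M /N !mul_mx_row !mul_row_col.
by rewrite !mul_tr_dotp !mul_scalar_mx addrA.
Qed.

Lemma dotp_frame z e1 e2 v w : orthoframe z e1 e2 ->
  dotp v w = dotp v z * dotp w z + dotp v e1 * dotp w e1 + dotp v e2 * dotp w e2.
Proof.
move=> F; rewrite {1}(orthoframe_decomp v F) !dotpDl !dotpZl.
by rewrite (dotpC z) (dotpC e1) (dotpC e2).
Qed.

Definition cross v w : 'rV[R]_3 := \row_j
  [:: v 0 1 * w 0 2 - v 0 2 * w 0 1; v 0 2 * w 0 0 - v 0 0 * w 0 2;
      v 0 0 * w 0 1 - v 0 1 * w 0 0]`_j.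

Lemma dotpE v w : dotp v w = v 0 0 * w 0 0 + v 0 1 * w 0 1 + v 0 2 * w 0 2.
Proof.
rewrite /dotp !big_ord_recl big_ord0 addr0 addrA.
by congr (_ + _ * _ + _ * _); congr (_ _ _); apply/val_inj.
Qed.

Lemma crossE v w : [/\ cross v w 0 0 = v 0 1 * w 0 2 - v 0 2 * w 0 1,
   cross v w 0 1 = v 0 2 * w 0 0 - v 0 0 * w 0 2 &
   cross v w 0 2 = v 0 0 * w 0 1 - v 0 1 * w 0 0].
Proof. by rewrite !mxE. Qed.

Lemma orthoframe_exists z v : sphere z -> tangent z v -> v != 0 ->
  exists e1 e2, orthoframe z e1 e2 /\ v = enorm v *: e1.
Proof.
move=> /sphereE zz zv v0.
have n0 : enorm v != 0 by rewrite gt_eqF // enorm_gt0.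
pose e1 := (enorm v)^-1 *: v.
have z1 : dotp z e1 = 0 by rewrite dotpZr zv mulr0.
have e11 : dotp e1 e1 = 1.
  by rewrite dotpZl dotpZr -sqr_enorm; field.
exists e1, (cross z e1); split; last by rewrite scalerA divff ?scale1r.
have [c0 c1 c2] := crossE z e1.
split => //; last split => //.
- transitivity (dotp z z * dotp e1 e1 - dotp z e1 ^+ 2).
    by rewrite !dotpE c0 c1 c2; ring.
  by rewrite zz e11 z1; ring.
- by rewrite dotpE c0 c1 c2; ring.
- by rewrite dotpE c0 c1 c2; ring.
Qed.

Lemma tangent_exists z : sphere z -> exists2 v, tangent z v & v != 0.
Proof.
move=> /sphereE zz.
pose a : 'rV[R]_3 := delta_mx 0 0; pose b : 'rV[R]_3 := delta_mx 0 1.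
have tc v : tangent z (cross z v).
  by have [c0 c1 c2] := crossE z v; rewrite /tangent /= dotpE c0 c1 c2; ring.
have [ca|ca] := eqVneq (cross z a) 0; last by exists (cross z a).
exists (cross z b) => //; apply/eqP => cb.
have [_ a1 a2] := crossE z a; have [_ _ b2] := crossE z b.
move: a1 a2 b2 zz; rewrite ca cb dotpE !mxE /= !mulr1 !mulr0 !subr0 sub0r.
move=> <- /eqP; rewrite eq_sym oppr_eq0 => /eqP -> <-.
by move=> /eqP; rewrite !mulr0 !addr0 eq_sym oner_eq0.
Qed.

Lemma tangent_frame z e1 e2 : orthoframe z e1 e2 ->
  [/\ sphere z, tangent z e1 & tangent z e2].
Proof. by move=> [zz _ _ [z1 z2 _]]; split=> //; apply/sphereE. Qed.

End frames.

(** * Eigenvalues of the tensor in an orthonormal frame *)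

Section eigenvalues.
Context {R : realType}.
Implicit Types (u : 'rV[R]_3 -> R) (z e v w : 'rV[R]_3).

Lemma sphere_deriveD u z v v' w : Ck_sphere 2 u -> z != 0 ->
  'D_(v + v') ('D_w (u \o @retract R)) z =
  'D_v ('D_w (u \o @retract R)) z + 'D_v' ('D_w (u \o @retract R)) z.
Proof.
rewrite /Ck_sphere => Cu z0; exact: (Ck_deriveD _ _ open_neq0 (Ck_derive w Cu)).
Qed.

Lemma sphere_deriveZ u z (c : R) v w : Ck_sphere 2 u -> z != 0 ->
  'D_(c *: v) ('D_w (u \o @retract R)) z =
  c * 'D_v ('D_w (u \o @retract R)) z.
Proof.
rewrite /Ck_sphere => Cu z0; exact: (Ck_deriveZ _ _ (Ck_derive w Cu)).
Qed.

Lemma sphere_deriveC u z v w : Ck_sphere 2 u -> z != 0 ->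
  'D_v ('D_w (u \o @retract R)) z = 'D_w ('D_v (u \o @retract R)) z.
Proof.
rewrite /Ck_sphere => Cu z0; exact: (Ck_deriveC _ _ open_neq0 Cu).
Qed.

Lemma Ck_sphere1 u : Ck_sphere 2 u -> Ck_sphere 1 u.
Proof. by move=> [cu du]; split=> // v; have [? [? _]] := du v; split. Qed.

Lemma AtensorE u z v w : Ck_sphere 2 u -> sphere z -> tangent z v ->
  tangent z w ->
  Atensor u z v w = - 'D_v ('D_w (u \o @retract R)) z
    + 2^-1 * (du u z v * du u z w) - 4^-1 * enorm (grad u z) ^+ 2 * dotp v w
    + dotp v w.
Proof. by move=> Cu Sz zv zw; rewrite /Atensor hess_derive // mul1r. Qed.

(** Stated for an abstract form, to be applied to the Hessian and to the inner
    product. *)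
Lemma sym_bilinear_frame (B : 'rV[R]_3 -> 'rV[R]_3 -> R) e1 e2 (p q r s : R) :
  (forall v v' w, B (v + v') w = B v w + B v' w) ->
  (forall c v w, B (c *: v) w = c * B v w) ->
  (forall v w, B v w = B w v) ->
  B (p *: e1 + q *: e2) (r *: e1 + s *: e2) =
  p * r * B e1 e1 + (p * s + q * r) * B e1 e2 + q * s * B e2 e2.
Proof.
move=> BD BZ BC; rewrite BD !BZ !(BC _ (_ + _)) !BD !BZ (BC e2 e1); ring.
Qed.

Lemma Atensor_frame u z e1 e2 (p q r s : R) : Ck_sphere 2 u ->
  orthoframe z e1 e2 ->
  Atensor u z (p *: e1 + q *: e2) (r *: e1 + s *: e2) =
  p * r * Atensor u z e1 e1 + (p * s + q * r) * Atensor u z e1 e2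
  + q * s * Atensor u z e2 e2.
Proof.
move=> Cu F; have [Sz z1 z2] := tangent_frame F.
have z0 := sphere_neq0 Sz.
have tc (a b : R) : tangent z (a *: e1 + b *: e2).
  by rewrite /tangent /= dotpDr !dotpZr z1 z2 !mulr0 addr0.
rewrite !AtensorE //.
rewrite (@sym_bilinear_frame (fun v w => 'D_v ('D_w (u \o @retract R)) z)).
- rewrite (@sym_bilinear_frame (@dotp R)).
  + rewrite !(du_grad _ (Ck_sphere1 Cu) Sz) !dotpDl !dotpZl.
    move: ('D_e1 ('D_e1 _) z) ('D_e1 ('D_e2 _) z) ('D_e2 ('D_e2 _) z) => h11 h12 h22.
    move: (dotp e1 (grad u z)) (dotp e2 (grad u z)) (enorm _ ^+ 2) => d1 d2 n.
    move: (dotp e1 e1) (dotp e1 e2) (dotp e2 e2) => g11 g12 g22; ring.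
  + exact: dotpDl.
  + exact: dotpZl.
  + exact: dotpC.
- by move=> v v' w; exact: sphere_deriveD.
- by move=> c v w; exact: sphere_deriveZ.
- by move=> v w; exact: sphere_deriveC.
Qed.

Lemma char_poly_factor2 (M : 'M[R]_2) (a b : R) :
  char_poly M = ('X - a%:P) * ('X - b%:P) ->
  \tr M = a + b /\ \det M = a * b.
Proof.
move=> E.
have E2 : char_poly M = 'X * 'X - (a + b)%:P * 'X + (a * b)%:P.
  by rewrite E polyCD polyCM; ring.
split.
  apply: oppr_inj; rewrite -char_poly_trace // E2.
  rewrite !(coefD, coefN, coefMX, coefCM, coefX, coefC) /=; ring.
have := char_poly_det M; rewrite E2 expr2 mulrNN !mul1r => <-.
rewrite !(coefD, coefN, coefMX, coefCM, coefX, coefC) /=; ring.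
Qed.

Lemma mx2_tr (M : 'M[R]_2) : \tr M = M 0 0 + M 1 1.
Proof.
rewrite /mxtrace !big_ord_recl big_ord0 addr0.
by congr (_ + M _ _); apply/val_inj.
Qed.

Lemma det_mx22 (M : 'M[R]_2) : \det M = M 0 0 * M 1 1 - M 0 1 * M 1 0.
Proof.
rewrite (expand_det_row _ ord0) !big_ord_recl big_ord0 addr0 /cofactor.
rewrite !det_mx11 !mxE /= expr0 mul1r expr1 mulN1r mulrN.
by congr (_ * M _ _ - M _ _ * M _ _); apply/val_inj.
Qed.

(** If the rows of [E] are those of [P] in the frame, then the matrices of the
    metric and of the tensor in the basis [E] are [e^u P P^T] and [P S P^T], so
    the endomorphism is conjugate to [e^(-u) S]. *)
Lemma eigenvalues_frame u z e1 e2 l : Ck_sphere 2 u ->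
  orthoframe z e1 e2 -> eigenvalues_gA u z l ->
  Atensor u z e1 e1 + Atensor u z e2 e2 = expR (u z) * (l.1 + l.2) /\
  Atensor u z e1 e1 * Atensor u z e2 e2 - Atensor u z e1 e2 ^+ 2
    = expR (u z) ^+ 2 * (l.1 * l.2).
Proof.
move=> Cu F [E [Efree Etan]] /=.
have [zz e11 e22 [z1 z2 e12]] := F.
pose a := Atensor u z e1 e1; pose k := Atensor u z e1 e2.
pose c := Atensor u z e2 e2.
pose P := \matrix_(i < 2, j < 2) dotp (row i E) (if j == 0 then e1 else e2).
pose S := \matrix_(i < 2, j < 2) (if i == 0 then (if j == 0 then a else k)
   else (if j == 0 then k else c)).
have rowE i : row i E = P i 0 *: e1 + P i 1 *: e2.
  rewrite {1}(orthoframe_decomp (row i E) F) !mxE /= dotpC Etan scale0r add0r.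
  by [].
have sum2 (f : 'I_2 -> R) : \sum_i f i = f 0 + f 1.
  by rewrite !big_ord_recl big_ord0 addr0; congr (_ + f _); apply/val_inj.
have GE : \matrix_(i < 2, j < 2) gmetric u z (row i E) (row j E)
    = expR (u z) *: (P *m P^T).
  apply/matrixP => i j; rewrite [LHS]mxE /gmetric [in RHS]mxE; congr (_ * _).
  rewrite mxE sum2 !rowE [P^T _ _]mxE [P^T _ _]mxE.
  by rewrite !(dotpDl, dotpDr, dotpZl, dotpZr) (dotpC e2 e1) e11 e22 e12; ring.
have AE : \matrix_(i < 2, j < 2) Atensor u z (row i E) (row j E)
    = P *m S *m P^T.
  apply/matrixP => i j; rewrite [LHS]mxE [RHS]mxE sum2.
  rewrite ![(P *m S) _ _]mxE !sum2 ![P^T _ _]mxE ![S _ _]mxE /=.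
  rewrite !rowE Atensor_frame // -/a -/c -/k; ring.
rewrite GE AE.
have Punit : P \in unitmx.
  rewrite -row_free_unit /row_free eqn_leq rank_leq_row /=.
  have EP : E = P *m \matrix_(j < 2) (if j == 0 then e1 else e2).
    apply/row_matrixP => i; rewrite rowE row_mul.
    apply/rowP => j; rewrite !mxE sum2 !mxE /=.
    by [].
  by rewrite -{1}(eqP Efree) {1}EP mxrankM_maxl.
have PTunit : P^T \in unitmx by rewrite unitmx_tr.
have eu0 : expR (u z) != 0 by rewrite gt_eqF // expR_gt0.
pose M := (expR (u z))^-1 *: (invmx P^T *m S *m P^T).
have GM : P *m S *m P^T = (expR (u z) *: (P *m P^T)) *m M.
  rewrite /M -scalemxAr -scalemxAl scalerA mulVf // scale1r.
  by rewrite -!mulmxA (mulmxA P^T) mulmxV // mul1mx.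
rewrite GM mulKmx; last by rewrite unitmxZ ?unitmx_mul ?Punit ?unitfE.
move=> /char_poly_factor2 [tM dM].
have trM : \tr M = (expR (u z))^-1 * (a + c).
  by rewrite /M mxtraceZ mxtrace_mulC mulmxA mulmxV // mul1mx mx2_tr !mxE.
have detM : \det M = (expR (u z))^-1 ^+ 2 * (a * c - k ^+ 2).
  have dP : \det P^T != 0 by rewrite -unitfE -unitmxE.
  rewrite /M detZ !det_mulmx det_inv (det_mx22 S) !mxE /=.
  by move: (\det P^T) dP => d dP; field; rewrite dP eu0.
rewrite -/a -/c -/k -tM -dM trM detM; split; field; exact: eu0.
Qed.

(** The diagonal entries of a symmetric matrix have the same sum as its
    eigenvalues and at least the same product, so they are closer to each
    other; this preserves membership in the cone. *)
Lemma Gamma_frame_gt0 u z e1 e2 l (p : R) : 1 < p <= 2 -> Ck_sphere 2 u ->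
  orthoframe z e1 e2 -> eigenvalues_gA u z l -> Gamma p l ->
  0 < Atensor u z e1 e1 + (2 - p) * Atensor u z e2 e2.
Proof.
move=> /andP[p1 p2] Cu F el [g1 g2].
have [] := eigenvalues_frame Cu F el.
set a := Atensor u z e1 e1; set c := Atensor u z e2 e2.
set k := Atensor u z e1 e2; set m := expR (u z).
have m0 : 0 < m by exact: expR_gt0.
move: g1 g2; set l1 := l.1; set l2 := l.2 => g1 g2 tr det.
have x1 : 0 < m * l1 + (2 - p) * (m * l2).
  by rewrite mulrCA -mulrDr mulr_gt0 //; lra.
have x2 : 0 < m * l2 + (2 - p) * (m * l1).
  by rewrite mulrCA -mulrDr mulr_gt0 //; lra.
have ac : (m * l1) * (m * l2) <= a * c.
  have -> : m * l1 * (m * l2) = m ^+ 2 * (l1 * l2) by ring.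
  by rewrite -det gerBl sqr_ge0.
have tr' : a + c = m * l1 + m * l2 by rewrite tr; ring.
move: x1 x2 ac tr'; set x := m * l1; set y := m * l2 => x1 x2 ac tr'.
(* Both factors are positive, because their sum and their product are. *)
have prod : 0 < (a + (2 - p) * c) * (c + (2 - p) * a).
  have -> : (a + (2 - p) * c) * (c + (2 - p) * a) =
     (x + (2 - p) * y) * (y + (2 - p) * x) + (1 - (2 - p)) ^+ 2 * (a * c - x * y).
    have -> : a = x + y - c by rewrite -tr' addrK.
    by ring.
  by rewrite ltr_pwDl ?mulr_gt0 // mulr_ge0 ?sqr_ge0 ?subr_ge0.
have sum : 0 < (a + (2 - p) * c) + (c + (2 - p) * a).
  have -> : (a + (2 - p) * c) + (c + (2 - p) * a) =
    (x + (2 - p) * y) + (y + (2 - p) * x).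
    have -> : a = x + y - c by rewrite -tr' addrK.
    by ring.
  exact: addr_gt0.
rewrite ltNge; apply/negP => neg; move: prod.
rewrite ltNge mulr_le0_ge0 //; lra.
Qed.

End eigenvalues.

(** * Touching from above along great circles *)

Section touching.
Context {R : realType}.
Implicit Types (u : 'rV[R]_3 -> R) (x y z v w : 'rV[R]_3).

Lemma grad_frame u z e1 e2 : Ck_sphere 1 u -> orthoframe z e1 e2 ->
  enorm (grad u z) ^+ 2 = du u z e1 ^+ 2 + du u z e2 ^+ 2.
Proof.
move=> Cu F; have [Sz _ _] := tangent_frame F.
rewrite sqr_enorm (dotp_frame _ _ F).
have := du_radial Cu Sz; rewrite !(du_grad _ Cu Sz) dotpC => ->.
by rewrite mul0r add0r !expr2 !(dotpC (grad u z)).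
Qed.

Lemma is_derive_combination (f g h : R -> R) (k t df dg dh : R) :
  is_derive t 1 f df -> is_derive t 1 g dg -> is_derive t 1 h dh ->
  is_derive t 1 (fun t => f t + k * g t - h t) (df + k * dg - dh).
Proof.
move=> Df Dg Dh.
exact: is_deriveB (is_deriveD Df (is_derive_scale k Dg)) Dh.
Qed.

(** Here [e^c e^(g t) / sqrt (1 + t^2)] is a barrier for [e^(-u/2)] on the
    great circle through [z] with direction [v], equal to it at [z].  The first
    derivatives agree and the second ones are ordered.  The function [1 + t^2]
    is spelled with its three coefficients, as in [second_order_log]. *)
Lemma touching u z v (g g1 : R -> R) (g2 c : R) :
  Ck_sphere 2 u -> sphere z -> tangent z v -> dotp v v = 1 ->
  (forall t : R, is_derive t 1 g (g1 t)) -> is_derive (0 : R) 1 g1 g2 ->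
  - u z / 2 = c + g 0 ->
  (forall t : R, - u (retract (t *: v + z)) / 2
     <= c + g t - 2^-1 * ln (1 + 0 * t + 1 * t ^+ 2)) ->
  du u z v = - 2 * g1 0 /\
  Atensor u z v v <= 2 * g2 - 1 + 2 * g1 0 ^+ 2 - 4^-1 * enorm (grad u z) ^+ 2.
Proof.
move=> Cu Sz zv vv dg dg1 g0 gle.
have pos (t : R) : 0 < 1 + 0 * t + 1 * t ^+ 2.
  by rewrite mul0r addr0 mul1r ltr_pwDl // sqr_ge0.
have [dN dN1] := second_order_log pos.
have CuU : Ck 2 [set y : 'rV[R]_3 | y != 0] (u \o @retract R) := Cu.
have dU (t : R) : is_derive t 1 (fun t => (u \o @retract R) (t *: v + z))
    ('D_v (u \o @retract R) (t *: v + z)).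
  by apply: is_derive_line; apply: (Ck_derivable CuU); exact: tangent_line_neq0.
have dU1 : is_derive (0 : R) 1 (fun t => 'D_v (u \o @retract R) (t *: v + z))
    ('D_v ('D_v (u \o @retract R)) z).
  have := @is_derive_line R _ ('D_v (u \o @retract R)) z v 0.
  rewrite scale0r add0r; apply; apply: (Ck_derivable (Ck_derive v CuU)).
  exact: sphere_neq0.
have minF t : (u \o @retract R) (0 *: v + z) + 2 * g 0 - ln (1 + 0 * 0 + 1 * 0 ^+ 2)
    <= (u \o @retract R) (t *: v + z) + 2 * g t - ln (1 + 0 * t + 1 * t ^+ 2).
  have := gle t.
  have -> : 1 + 0 * 0 + 1 * 0 ^+ 2 = 1 :> R by ring.
  rewrite ln1 /= scale0r add0r (retract_sphere Sz).
  lra.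
have [] := second_derivative_test
  (fun t => is_derive_combination 2 (dU t) (dg t) (dN t))
  (is_derive_combination 2 dU1 dg1 dN1) minF.
have -> : (0 + 2 * 1 * 0) / (1 + 0 * 0 + 1 * 0 ^+ 2) = 0 :> R by field.
rewrite scale0r add0r subr0 -/(du u z v) => d1 d2.
have duE : du u z v = - 2 * g1 0 by lra.
split=> //; rewrite AtensorE // vv duE.
move: d2; rewrite !divr1 expr0n subr0 !mulr1.
move: ('D_v _ z) (enorm _ ^+ 2) => h n h2.
have -> : - 2 * g1 0 * (- 2 * g1 0) = 4 * g1 0 ^+ 2 by ring.
lra.
Qed.

Lemma dotp_le_enorm y x : sphere x -> dotp y x <= enorm y.
Proof.
move=> /sphereE xx; apply: (le_trans (ler_norm _)).
rewrite -(ler_pXn2r (n := 2)) ?nnegrE ?normr_ge0 ?sqrtr_ge0 //.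
rewrite real_normK ?num_real // sqr_enorm -subr_ge0.
have := dotp_ge0 (y - dotp y x *: x).
rewrite !(dotpDl, dotpDr, dotpNl, dotpNr, dotpZl, dotpZr) xx (dotpC x y).
by congr (0 <= _); ring.
Qed.

Lemma dotp_sphere_lt1 y x : sphere y -> sphere x -> y != x -> dotp y x < 1.
Proof.
move=> /sphereE yy /sphereE xx yx.
have : 0 < dotp (y - x) (y - x) by rewrite dotp_gt0 subr_eq0.
rewrite !(dotpDl, dotpDr, dotpNl, dotpNr) xx yy (dotpC x y); lra.
Qed.

(** The functions [m - k (y.x)] are the building blocks of the barriers.  On a
    great circle they involve [sqrt (1 + t^2)]; replacing it by the larger [1 +
    t^2/2] keeps the value and the first two derivatives at [t = 0], and leaves
    a quadratic. *)
Lemma great_circle_quadratic z v x (m k : R) :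
  sphere z -> tangent z v -> dotp v v = 1 -> sphere x -> 0 < k <= m ->
  0 < m - k * dotp z x ->
  let q t := (m - k * dotp z x) + (- k * dotp v x) * t + (m / 2) * t ^+ 2 in
  (forall t : R, 0 < q t) /\
  forall t : R, m - k * dotp (retract (t *: v + z)) x
    <= q t / Num.sqrt (1 + 0 * t + 1 * t ^+ 2).
Proof.
move=> Sz zv vv Sx /andP[k0 km] q0 q.
have zz := (sphereE z).1 Sz.
pose N (t : R) := Num.sqrt (1 + 0 * t + 1 * t ^+ 2).
have eN t : enorm (t *: v + z) = N t.
  rewrite /enorm /N !(dotpDl, dotpDr, dotpZl, dotpZr) zz vv (dotpC v z) zv.
  by congr Num.sqrt; ring.
have pos (t : R) : 0 < 1 + 0 * t + 1 * t ^+ 2 :> R.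
  by rewrite mul0r addr0 mul1r ltr_pwDl // sqr_ge0.
have N0 t : 0 < N t by rewrite sqrtr_gt0.
have Nle t : N t <= 1 + t ^+ 2 / 2.
  have t2 := sqr_ge0 t.
  rewrite -(ler_pXn2r (n := 2)) ?nnegrE ?sqrtr_ge0 //; last by lra.
  rewrite (sqr_sqrtr (ltW (pos t))) -subr_ge0.
  have -> : (1 + t ^+ 2 / 2) ^+ 2 - (1 + 0 * t + 1 * t ^+ 2) = (t ^+ 2 / 2) ^+ 2.
    by field.
  exact: sqr_ge0.
have qN t : m * N t - k * (dotp z x + t * dotp v x) <= q t.
  have := ler_wpM2l (ltW (lt_le_trans k0 km)) (Nle t); rewrite /q; lra.
have dN t : dotp z x + t * dotp v x <= N t.
  by rewrite -eN -dotpZl -dotpDl addrC dotp_le_enorm.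
split=> t; last first.
  have eR : dotp (retract (t *: v + z)) x * N t = dotp z x + t * dotp v x.
    rewrite /retract dotpZl eN dotpDl dotpZl [_ + t * _]addrC.
    by rewrite mulrAC mulVf ?mul1r // gt_eqF.
  by rewrite -/(N t) (ler_pdivlMr _ _ (N0 t)) mulrBl -mulrA eR; exact: qN.
have [->|t0] := eqVneq t 0; first by rewrite /q !mulr0 expr0n /= mulr0 !addr0.
have t2 : 0 < t ^+ 2 by rewrite exprn_even_gt0.
have : N t < 1 + t ^+ 2 / 2.
  rewrite -(ltr_pXn2r (n := 2)) ?nnegrE ?sqrtr_ge0 //; last by lra.
  rewrite (sqr_sqrtr (ltW (pos t))) -subr_gt0.
  have -> : (1 + t ^+ 2 / 2) ^+ 2 - (1 + 0 * t + 1 * t ^+ 2) = (t ^+ 2 / 2) ^+ 2.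
    by field.
  by rewrite exprn_gt0 // divr_gt0.
have := dN t; have := ltW (N0 t); rewrite /q; move: (N t) => n n0 h1 h2.
have m0 := lt_le_trans k0 km.
have : 0 < m * (1 + t ^+ 2 / 2 - n) by rewrite mulr_gt0 // subr_gt0.
have : 0 <= k * (n - (dotp z x + t * dotp v x)).
  by rewrite mulr_ge0 ?subr_ge0 // ltW.
have : 0 <= (m - k) * n by rewrite mulr_ge0 ?subr_ge0.
lra.
Qed.

End touching.

(** * The two barriers *)

Section barriers.
Context {R : realType}.
Implicit Types (u : 'rV[R]_3 -> R) (x y z v w : 'rV[R]_3).

Lemma ln_sqrt (a : R) : 0 < a -> ln (Num.sqrt a) = 2^-1 * ln a.
Proof. by move=> a0; rewrite -powR12_sqrt ?ltW // ln_powR. Qed.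

Lemma ln_le_line (a q : R) (t : R) : 0 < a -> 0 < q ->
  a <= q / Num.sqrt (1 + 0 * t + 1 * t ^+ 2) ->
  ln a <= ln q - 2^-1 * ln (1 + 0 * t + 1 * t ^+ 2).
Proof.
have pos : 0 < 1 + 0 * t + 1 * t ^+ 2 :> R.
  by rewrite mul0r addr0 mul1r ltr_pwDl // sqr_ge0.
move=> a0 q0; rewrite -ln_sqrt //.
by rewrite -ln_div ?posrE ?sqrtr_gt0 // ler_ln ?posrE // divr_gt0 // sqrtr_gt0.
Qed.

Lemma dotp_sphere_le1 x y : sphere x -> sphere y -> dotp y x <= 1.
Proof. by move=> Sx Sy; have := dotp_le_enorm y Sx; rewrite Sy. Qed.

Lemma ln_ratio_le (a b U V : R) : 0 < V -> 0 < U ->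
  expR a / U <= expR b / V -> a <= ln (expR b / V) + ln U.
Proof.
move=> V0 U0; rewrite ler_pdivrMr // => H.
have e0 : 0 < expR b / V by rewrite divr_gt0 // expR_gt0.
rewrite -lnM ?posrE // -[leLHS]expRK ler_ln ?posrE ?expR_gt0 //.
exact: mulr_gt0.
Qed.

(** Here [W y] is [s^2 + |y - x|^2].  The trace of [2 W Hess W - |grad W|^2 g +
    W^2 g] is the constant [2 s^2 (s^2 + 4)], because [W] is the restriction of
    an affine function. *)
Lemma bubble_touching u x z s e1 e2 : Ck_sphere 2 u -> sphere x -> 0 < s ->
  let W y := s ^+ 2 + 2 - 2 * dotp y x in
  (forall y, sphere y -> expR (- u y / 2) / W y <= expR (- u z / 2) / W z) ->
  orthoframe z e1 e2 ->
  Atensor u z e1 e1 + Atensor u z e2 e2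
    <= 2 * s ^+ 2 * (s ^+ 2 + 4) / W z ^+ 2.
Proof.
move=> Cu Sx s0 W zmax F.
have [Sz z1 z2] := tangent_frame F.
have W0 y : sphere y -> 0 < W y.
  move=> Sy; have := dotp_sphere_le1 Sx Sy; have : 0 < s ^+ 2 by rewrite exprn_gt0.
  rewrite /W; lra.
have A0 : W z != 0 by rewrite lt0r_neq0 // W0.
pose m := s ^+ 2 + 2.
have key v : tangent z v -> dotp v v = 1 ->
    du u z v = 4 * dotp v x / W z /\
    Atensor u z v v <= 2 * m / W z - 1 - 4^-1 * enorm (grad u z) ^+ 2.
  move=> zv vv.
  have km : 0 < (2 : R) <= m by rewrite ltr0n /m lerDr sqr_ge0.
  have [qpos qle] := great_circle_quadratic Sz zv vv Sx km (W0 _ Sz).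
  have [dq dq1] := second_order_log qpos.
  pose c := ln (expR (- u z / 2) / W z).
  have logW y : sphere y -> - u y / 2 <= c + ln (W y).
    move=> Sy; exact: (ln_ratio_le (W0 _ Sz) (W0 _ Sy) (zmax _ Sy)).
  have [] := @touching R u z v _ _ _ c Cu Sz zv vv dq dq1.
  - rewrite mulr0 expr0n /= mulr0 !addr0 /c ln_div ?posrE ?expR_gt0 ?W0 // expRK.
    by rewrite subrK.
  - move=> t; set yt := retract _.
    have Sy : sphere yt by apply: sphere_retract; exact: tangent_line_neq0.
    apply: le_trans (logW _ Sy) _; rewrite -addrA lerD2l.
    apply: ln_le_line; [exact: W0|exact: qpos|exact: qle].
  rewrite !mulr0 expr0n /= mulr0 !addr0 -/(W z) -/m => d1 d2; split.
    by rewrite d1; field; rewrite A0.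
  apply: (le_trans d2); rewrite lerD2r le_eqVlt; apply/orP; left; apply/eqP.
  by field; rewrite A0.
have [zz e11 e22 _] := F.
have [d1 a1] := key _ z1 e11; have [d2 a2] := key _ z2 e22.
apply: (le_trans (lerD a1 a2)).
rewrite (grad_frame (Ck_sphere1 Cu) F) d1 d2.
have := dotp_frame x x F; rewrite ((sphereE x).1 Sx) !(dotpC x).
move=> xx; rewrite le_eqVlt; apply/orP; left; apply/eqP.
have mE : dotp z x = (m - W z) / 2 by rewrite /m /W; field.
have e2E : dotp e2 x ^+ 2 = 1 - ((m - W z) / 2) ^+ 2 - dotp e1 x ^+ 2.
  by rewrite -mE xx; ring.
have sE : s ^+ 2 = m - 2 by rewrite /m addrK.
rewrite sE; move: e2E A0; move: (W z) (dotp e1 x) (dotp e2 x) => A f1 f2 e2E A0.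
have -> : (4 * f1 / A) ^+ 2 + (4 * f2 / A) ^+ 2 = 16 * (f1 ^+ 2 + f2 ^+ 2) / A ^+ 2.
  by field.
by rewrite e2E; field.
Qed.

Lemma powR_le_line (b a q t : R) : 0 < b -> 0 <= a -> 0 < q ->
  a <= q / Num.sqrt (1 + 0 * t + 1 * t ^+ 2) ->
  a `^ b <= expR (b * ln q) * expR (- b * (2^-1 * ln (1 + 0 * t + 1 * t ^+ 2))).
Proof.
have pos : 0 < 1 + 0 * t + 1 * t ^+ 2 :> R.
  by rewrite mul0r addr0 mul1r ltr_pwDl // sqr_ge0.
move=> b0 a0 q0 aq; rewrite -ln_sqrt // -expRD.
have r0 : 0 < q / Num.sqrt (1 + 0 * t + 1 * t ^+ 2) by rewrite divr_gt0 // sqrtr_gt0.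
apply: le_trans (ge0_ler_powR (ltW b0) _ _ aq) _; rewrite ?nnegrE ?(ltW r0) //.
rewrite /powR gt_eqF // ln_div ?posrE ?sqrtr_gt0 //.
by rewrite mulrBr mulNr.
Qed.

(** The absolute values change nothing on the sphere; they make the base
    continuous around it, since [powR] equals 1 on negative numbers. *)
Definition two_pole (b : R) x y w : R :=
  (`|1 - dotp w x| `^ b + `|1 - dotp w y| `^ b) `^ b^-1.

Lemma two_pole_base_gt0 b x y w : sphere x -> sphere y -> sphere w -> x != y ->
  0 < `|1 - dotp w x| `^ b + `|1 - dotp w y| `^ b.
Proof.
move=> Sx Sy Sw xy; have [wx|wx] := eqVneq w x; last first.
  rewrite ltr_pwDl ?powR_ge0 // powR_gt0 // normr_gt0 subr_eq0 eq_sym.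
  by rewrite lt_eqF // dotp_sphere_lt1.
rewrite ltr_wpDl ?powR_ge0 // powR_gt0 // normr_gt0 subr_eq0 eq_sym.
by rewrite lt_eqF // dotp_sphere_lt1 // wx.
Qed.

(** The tensor of the barrier equals [P Q D (g - 2 (1 - b) n n)], where [P] and
    [Q] are the weights of the two poles and [n] is the unit vector along [grad
    ln (S / T)], whose squared length is [D].  In the frame with [e1 = n] the
    combination below is then exactly [P Q D (1 - 2 (1 - b) + 1 - 2 b) = 0]. *)
Lemma two_pole_touching u x y z (b : R) : Ck_sphere 2 u ->
  sphere x -> sphere y -> sphere z -> x != y -> z != x -> z != y ->
  0 < b -> 0 <= 1 - 2 * b ->
  (forall w, sphere w -> expR (- u w / 2) / two_pole b x y w
     <= expR (- u z / 2) / two_pole b x y z) ->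
  exists e1 e2, orthoframe z e1 e2 /\
    Atensor u z e1 e1 + (1 - 2 * b) * Atensor u z e2 e2 <= 0.
Proof.
move=> Cu Sx Sy Sz xy zx zy b0 b1 zmax.
pose S := 1 - dotp z x; pose T := 1 - dotp z y; pose K := 1 - dotp x y.
have S0 : 0 < S by rewrite subr_gt0 dotp_sphere_lt1.
have T0 : 0 < T by rewrite subr_gt0 dotp_sphere_lt1.
have K0 : 0 < K by rewrite subr_gt0 dotp_sphere_lt1.
have W0 w : sphere w -> 0 < two_pole b x y w.
  by move=> Sw; rewrite powR_gt0 // two_pole_base_gt0.
pose P := expR (b * ln S) / (expR (b * ln S) + expR (b * ln T)).
pose Q := expR (b * ln T) / (expR (b * ln S) + expR (b * ln T)).
have PQ : P + Q = 1.
  by rewrite /P /Q -mulrDl divff // gt_eqF // addr_gt0 // expR_gt0.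
have P0 : 0 <= P by rewrite divr_ge0 ?addr_ge0 ?expR_ge0.
have Q0 : 0 <= Q by rewrite divr_ge0 ?addr_ge0 ?expR_ge0.
have key v : tangent z v -> dotp v v = 1 ->
    du u z v = 2 * (P * (dotp v x / S) + Q * (dotp v y / T)) /\
    Atensor u z v v <= 2 * (P / S + Q / T) - 1
      - 2 * (1 - b) * P * Q * (dotp v x / S - dotp v y / T) ^+ 2
      - 4^-1 * enorm (grad u z) ^+ 2.
  move=> zv vv.
  have k1 : 0 < (1 : R) <= 1 by rewrite ltr01 lexx.
  have [qx qxle] := great_circle_quadratic Sz zv vv Sx k1 (ltac:(by rewrite mul1r)).
  have [qy qyle] := great_circle_quadratic Sz zv vv Sy k1 (ltac:(by rewrite mul1r)).
  have [dx dx1] := second_order_log qx.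
  have [dy dy1] := second_order_log qy.
  have [g1 [dg g10 dg1]] := second_order_logsum (lt0r_neq0 b0) dx dy dx1 dy1.
  pose c := ln (expR (- u z / 2) / two_pole b x y z).
  have logW w : sphere w -> - u w / 2 <= c + ln (two_pole b x y w).
    move=> Sw; exact: (ln_ratio_le (W0 _ Sz) (W0 _ Sw) (zmax _ Sw)).
  have [] := @touching R u z v _ _ _ c Cu Sz zv vv dg dg1.
  - rewrite !mulr0 expr0n /= !mulr0 !addr0 !mul1r /c -/S -/T.
    rewrite ln_div ?posrE ?expR_gt0 ?W0 // expRK.
    rewrite /two_pole ln_powR -/S -/T !gtr0_norm // /powR !gt_eqF //.
    by rewrite subrK.
  - move=> t; set wt := retract _.
    have Sw : sphere wt by apply: sphere_retract; exact: tangent_line_neq0.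
    apply: le_trans (logW _ Sw) _; rewrite -addrA lerD2l.
    rewrite /two_pole ln_powR.
    have xge : 0 <= 1 - dotp wt x by rewrite subr_ge0 dotp_sphere_le1.
    have yge : 0 <= 1 - dotp wt y by rewrite subr_ge0 dotp_sphere_le1.
    have hx := qxle t; have hy := qyle t.
    rewrite [1 * dotp wt x]mul1r in hx; rewrite [1 * dotp wt y]mul1r in hy.
    have := lerD (powR_le_line b0 xge (qx t) hx) (powR_le_line b0 yge (qy t) hy).
    have sp : 0 < (1 - dotp wt x) `^ b + (1 - dotp wt y) `^ b.
      by have := two_pole_base_gt0 b Sx Sy Sw xy; rewrite !ger0_norm.
    have se : 0 < expR (b * ln (1 - 1 * dotp z x + -1 * dotp v x * t + 1 / 2 * t ^+ 2))
        + expR (b * ln (1 - 1 * dotp z y + -1 * dotp v y * t + 1 / 2 * t ^+ 2)).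
      by rewrite addr_gt0 ?expR_gt0.
    rewrite -mulrDl -ler_ln ?posrE // ?mulr_gt0 ?expR_gt0 //.
    rewrite lnM ?posrE ?addr_gt0 ?expR_gt0 // expRK !ger0_norm // => H.
    rewrite -(ler_pM2l (x := b^-1)) ?invr_gt0 // in H.
    apply: (le_trans H); rewrite mulrDr lerD2l mulrA mulrN mulVf ?mulN1r //.
    exact: lt0r_neq0.
  rewrite g10 !mulr0 expr0n /= !mulr0 !addr0 !mul1r -/S -/T -/P -/Q.
  move: (dotp v x) (dotp v y) => vx vy d1 d2; split.
    by rewrite d1; field; rewrite !gt_eqF.
  apply: (le_trans d2); rewrite lerD2r le_eqVlt; apply/orP; left; apply/eqP.
  have -> : P = 1 - Q by rewrite -PQ addrK.
  by field; rewrite !gt_eqF.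
(* Up to sign, [xt] is the gradient of [ln (S / T)] at [z]. *)
pose xi := S^-1 *: x - T^-1 *: y.
pose xt := xi - dotp z xi *: z.
have zz := (sphereE z).1 Sz.
have zt : tangent z xt.
  by rewrite /tangent /= /xt dotpDr dotpNr dotpZr zz mulr1 subrr.
have xt0 : xt != 0.
  rewrite -dotp_gt0.
  have -> : dotp xt xt = 2 * K / (S * T).
    rewrite /xt /xi !(dotpDl, dotpDr, dotpNl, dotpNr, dotpZl, dotpZr) zz.
    rewrite ((sphereE x).1 Sx) ((sphereE y).1 Sy) (dotpC x z) (dotpC y z) (dotpC y x).
    have -> : dotp z x = 1 - S by rewrite /S; ring.
    have -> : dotp z y = 1 - T by rewrite /T; ring.
    have -> : dotp x y = 1 - K by rewrite /K; ring.
    by field; rewrite !gt_eqF.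
  by rewrite divr_gt0 ?mulr_gt0.
have [e1 [e2 [F xtE]]] := orthoframe_exists Sz zt xt0.
have [_ z1 z2] := tangent_frame F.
have [_ e11 e22 [_ _ e12]] := F.
exists e1, e2; split => //.
have [d1 a1] := key _ z1 e11; have [d2 a2] := key _ z2 e22.
have XY2 : dotp e2 y / T = dotp e2 x / S.
  have : dotp e2 xi = 0.
    have -> : xi = xt + dotp z xi *: z by rewrite subrK.
    rewrite xtE dotpDr !dotpZr (dotpC e2 e1) (dotpC e2 z) e12.
    by rewrite z2 !mulr0 addr0.
  rewrite /xi dotpDr dotpNr !dotpZr => /eqP; rewrite subr_eq0 => /eqP E.
  by rewrite mulrC -E mulrC.
have sq p (q : R) : sphere p -> 0 < q -> q = 1 - dotp z p ->
    (dotp e1 p / q) ^+ 2 + (dotp e2 p / q) ^+ 2 = 2 / q - 1.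
  move=> Sp q0 qE; have := dotp_frame p p F.
  rewrite ((sphereE p).1 Sp) !(dotpC p).
  have -> : dotp z p = 1 - q by rewrite qE; ring.
  move=> E; have E2 : dotp e2 p ^+ 2 = 1 - (1 - q) ^+ 2 - dotp e1 p ^+ 2.
    by rewrite {1}E; ring.
  by rewrite !expr_div_n E2; field; rewrite gt_eqF.
have sx := sq x S Sx S0 erefl; have sy := sq y T Sy T0 erefl.
have a2' := ler_wpM2l b1 a2.
apply: (le_trans (lerD a1 a2')).
rewrite (grad_frame (Ck_sphere1 Cu) F) d1 d2 -/S -/T XY2.
rewrite XY2 in sy.
(* The inner product of [x] and [y] cancels: only [sx], [sy] and [P + Q = 1] remain. *)
have -> : 2 * (P / S + Q / T) - 1 = P * (2 / S - 1) + Q * (2 / T - 1).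
  by rewrite -[X in _ - X]PQ; ring.
rewrite -sx -sy; move: (dotp e1 x / S) (dotp e1 y / T) (dotp e2 x / S) => X Y Z.
rewrite le_eqVlt; apply/orP; left; apply/eqP.
have -> : P = 1 - Q by rewrite -PQ addrK.
by field.
Qed.

End barriers.

(** * Maxima on the sphere *)

Section two_point.
Context {R : realType}.
Implicit Types (u : 'rV[R]_3 -> R) (x y z v w : 'rV[R]_3).

Lemma continuous_dotp x : continuous (fun y => dotp y x).
Proof.
move=> y; have -> : (fun y => dotp y x) =
    (fun y => y 0 0 * x 0 0 + y 0 1 * x 0 1 + y 0 2 * x 0 2).
  by apply/funext => w; exact: dotpE.
have c i : {for y, continuous (fun y : 'rV[R]_3 => y 0 i * x 0 i)}.
  by apply: continuousM; [exact: coord_continuous|exact: cst_continuous].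
exact: continuousD (continuousD (c 0) (c 1)) (c 2).
Qed.

Lemma continuous_sqr_dotp : continuous (fun y : 'rV[R]_3 => dotp y y).
Proof.
move=> y; have -> : (fun y => dotp y y) =
    (fun y : 'rV[R]_3 => y 0 0 * y 0 0 + y 0 1 * y 0 1 + y 0 2 * y 0 2).
  by apply/funext => w; exact: dotpE.
have c i : {for y, continuous (fun y : 'rV[R]_3 => y 0 i * y 0 i)}.
  by apply: continuousM; exact: coord_continuous.
exact: continuousD (continuousD (c 0) (c 1)) (c 2).
Qed.

Lemma closed_sphere : closed (@sphere R).
Proof.
have -> : @sphere R = (fun y => dotp y y) @^-1` [set 1].
  by apply/seteqP; split=> y /sphereE.
apply: (@closed_comp _ _ (fun y => dotp y y) [set 1]); last exact: closed_eq.
by move=> y _; exact: continuous_sqr_dotp.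
Qed.

Lemma compact_sphere : compact (@sphere R).
Proof.
apply: bounded_closed_compact closed_sphere.
exists 1; split; first exact: num_real.
move=> M M1 y /sphereE yy; rewrite /Num.Def.normr /= mx_normrE.
apply: bigmax_le; first exact: ltW (lt_trans ltr01 M1).
move=> [i j] _ /=; rewrite ord1; apply: le_trans (ltW M1).
rewrite -(ler_pXn2r (n := 2)) ?nnegrE ?ler01 // expr1n -yy real_normK ?num_real //.
rewrite /dotp (bigD1 j) //= -expr2 lerDl sumr_ge0 // => k _.
by rewrite -expr2 sqr_ge0.
Qed.

Lemma sphere_max (h : 'rV[R]_3 -> R) :
  (forall y, sphere y -> {for y, continuous h}) ->
  exists2 z, sphere z & forall y, sphere y -> h y <= h z.
Proof.
move=> ch.
have S0 : @sphere R !=set0.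
  exists (delta_mx 0 0); apply/sphereE.
  by rewrite dotpE !mxE /= !mulr0 !addr0 mulr1.
have cw : {within @sphere R, continuous h}.
  by apply/continuous_in_subspaceT => y; rewrite inE; exact: ch.
have [z zS zmax] := EVT_max_rV S0 compact_sphere cw.
exists z; first by move: zS; rewrite inE.
by move=> y yS; apply: zmax; rewrite inE.
Qed.

Lemma continuous_sphere_exp u y : Ck_sphere 2 u -> sphere y ->
  {for y, continuous (fun w => expR (- (u (retract w)) / 2))}.
Proof.
move=> Cu Sy; have CU : Ck 2 [set y : 'rV[R]_3 | y != 0] (u \o @retract R) := Cu.
have cu := Ck_continuous CU (sphere_neq0 Sy).
apply: (@continuous_comp _ _ _ (fun w => - u (retract w) / 2) expR);
  last exact: continuous_expR.
apply: continuousM; last exact: cst_continuous.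
  exact: (@continuousN _ _ _ (u \o @retract R) y cu).
Qed.

Lemma continuous_normr_powR (b : R) : 0 < b ->
  continuous (fun a : R => `|a| `^ b).
Proof.
move=> b0 a; have [->|a0] := eqVneq a 0; last first.
  apply: (@continuous_comp _ _ _ (fun a : R => `|a|) (fun a => a `^ b)).
    exact: norm_continuous.
  have n0 : 0 < `|a| by rewrite normr_gt0.
  have [d _] := is_derive1_powR b n0.
  exact/differentiable_continuous/derivable1_diffP.
rewrite /continuous_at normr0 powR0 ?gt_eqF //.
apply/cvgrPdist_lt => e e0.
have d0 : 0 < e `^ b^-1 by rewrite powR_gt0.
exists (e `^ b^-1) => //= t; rewrite /ball_ /= [0 - t]sub0r normrN => td.
rewrite sub0r normrN ger0_norm ?powR_ge0 //.
have := gt0_ltr_powR b0 (normr_ge0 t) (ltW d0) td.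
by rewrite -powRrM mulVf ?gt_eqF // powRr1 // ltW.
Qed.

Lemma continuous_two_pole (b : R) x y w : 0 < b -> sphere x -> sphere y ->
  sphere w -> x != y -> {for w, continuous (two_pole b x y)}.
Proof.
move=> b0 Sx Sy Sw xy.
have c1 p : {for w, continuous (fun w => `|1 - dotp w p| `^ b)}.
  apply: (@continuous_comp _ _ _ (fun w => 1 - dotp w p) (fun a => `|a| `^ b)).
    by apply: continuousB; [exact: cst_continuous|exact: continuous_dotp].
  exact: continuous_normr_powR.
apply: (@continuous_comp _ _ _ (fun w => `|1 - dotp w x| `^ b + `|1 - dotp w y| `^ b)
  (fun a => a `^ b^-1)).
  by apply: continuousD; exact: c1.
have [d _] := is_derive1_powR b^-1 (two_pole_base_gt0 b Sx Sy Sw xy).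
exact/differentiable_continuous/derivable1_diffP.
Qed.

Lemma sphere_ratio_max u (W : 'rV[R]_3 -> R) : Ck_sphere 2 u ->
  (forall y, sphere y -> {for y, continuous W}) ->
  (forall y, sphere y -> 0 < W y) ->
  exists2 z, sphere z & forall y, sphere y ->
    expR (- u y / 2) / W y <= expR (- u z / 2) / W z.
Proof.
move=> Cu cW W0.
have ch y : sphere y ->
    {for y, continuous (fun y => expR (- u (retract y) / 2) / W y)}.
  move=> Sy; apply: continuousM; first exact: continuous_sphere_exp.
  by apply: continuousV; [rewrite gt_eqF // W0|exact: cW].
have [z Sz zmax] := sphere_max ch.
exists z => // y Sy; have := zmax y Sy.
by rewrite (retract_sphere Sy) (retract_sphere Sz).
Qed.

End two_point.

(** * Separation of two concentration points *)

Section separation.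
Context {R : realType}.
Implicit Types (u : 'rV[R]_3 -> R) (x y z v w : 'rV[R]_3).

(** The quadratic of [s] is at most 4 times that of [s / 2], so the maximal
    ratio at scale [s / 2] is at most [2 a / (s / 2)], whereas by
    [bubble_touching] it cannot lie between [a / (s / 2)] and that bound, which
    would give [c <= 40 a^2]. *)
Lemma bubble_halving u x (a c s : R) : Ck_sphere 2 u -> sphere x ->
  (forall z e1 e2, orthoframe z e1 e2 ->
    c * expR (u z) <= Atensor u z e1 e1 + Atensor u z e2 e2) ->
  0 < a -> 40 * a ^+ 2 < c -> 0 < s <= 2 ->
  (forall z, sphere z -> expR (- u z / 2) <= a / s * (s ^+ 2 + 2 - 2 * dotp z x)) ->
  (forall z, sphere z ->
    expR (- u z / 2) <= a / (s / 2) * ((s / 2) ^+ 2 + 2 - 2 * dotp z x)).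
Proof.
move=> Cu Sx tr a0 ac /andP[s0 s2] Ps.
have s20 : 0 < s / 2 by rewrite divr_gt0.
pose W y := (s / 2) ^+ 2 + 2 - 2 * dotp y x.
have W0 y : sphere y -> 0 < W y.
  move=> Sy; have := dotp_sphere_le1 Sx Sy.
  have : 0 < (s / 2) ^+ 2 by rewrite exprn_gt0.
  rewrite /W; lra.
have cW y : sphere y -> {for y, continuous W}.
  move=> Sy; apply: continuousB; first exact: cst_continuous.
  by apply: continuousM; [exact: cst_continuous|exact: continuous_dotp].
have [z Sz zmax] := sphere_ratio_max Cu cW W0.
pose t := expR (- u z / 2) / W z.
have tW : expR (- u z / 2) = t * W z by rewrite /t divfK // gt_eqF // W0.
have t0 : 0 < t by rewrite divr_gt0 ?expR_gt0 ?W0.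
suff tle : t <= a / (s / 2).
  move=> y Sy; have := zmax y Sy; rewrite -/t ler_pdivrMr ?W0 // => /le_trans; apply.
  by rewrite ler_pM2r ?W0.
rewrite leNgt; apply/negP => tgt.
have tle : t <= 4 * a / s.
  rewrite ler_pdivrMr ?W0 //; apply: (le_trans (Ps z Sz)).
  have -> : 4 * a / s * W z = a / s * (4 * W z) by field; rewrite gt_eqF.
  rewrite ler_pM2l ?divr_gt0 // /W.
  have := dotp_sphere_le1 Sx Sz.
  have -> : (s / 2) ^+ 2 = s ^+ 2 / 4 by field.
  lra.
have [v zv v0] := tangent_exists Sz.
have [e1 [e2 [F _]]] := orthoframe_exists Sz zv v0.
have := le_trans (tr _ _ _ F) (bubble_touching Cu Sx s20 zmax F).
have eu : expR (u z) = (t * W z) ^- 2.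
  rewrite -tW -expRM_natl -expRN; congr expR; by field.
rewrite eu exprMn invfM mulrA ler_pM2r ?invr_gt0 ?exprn_gt0 ?W0 //.
rewrite ler_pdivrMr ?exprn_gt0 // => H.
have st1 : s / 2 * t <= 2 * a.
  rewrite -(_ : s / 2 * (4 * a / s) = 2 * a); last by field; rewrite gt_eqF.
  by rewrite ler_pM2l.
have st : (s / 2 * t) ^+ 2 <= 4 * a ^+ 2.
  have -> : 4 * a ^+ 2 = (2 * a) ^+ 2 by ring.
  rewrite ler_sqr // nnegrE; first exact: mulr_ge0 (ltW s20) (ltW t0).
  by rewrite mulr_ge0 // ltW.
have s5 : (s / 2) ^+ 2 + 4 <= 5.
  have : (s / 2) ^+ 2 <= 1 ^+ 2 by rewrite ler_sqr ?nnegrE ?ler01 ?(ltW s20) //; lra.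
  rewrite expr1n; lra.
have st0 : 0 <= (s / 2 * t) ^+ 2 by exact: sqr_ge0.
have : 2 * (s / 2) ^+ 2 * ((s / 2) ^+ 2 + 4) * t ^+ 2 <= 2 * (4 * a ^+ 2) * 5.
  have -> : 2 * (s / 2) ^+ 2 * ((s / 2) ^+ 2 + 4) * t ^+ 2
     = 2 * (s / 2 * t) ^+ 2 * ((s / 2) ^+ 2 + 4) by ring.
  apply: ler_pM => //; first by rewrite mulr_ge0.
    by rewrite addr_ge0 ?sqr_ge0.
  by move: st; lra.
lra.
Qed.

(** At [z = x], the bound at scale [s / 2^n] is [e^(-u x / 2) <= a s / 2^n]. *)
Lemma no_bubble_above u x (a c s : R) : Ck_sphere 2 u -> sphere x ->
  (forall z e1 e2, orthoframe z e1 e2 ->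
    c * expR (u z) <= Atensor u z e1 e1 + Atensor u z e2 e2) ->
  0 < a -> 40 * a ^+ 2 < c -> 0 < s <= 2 ->
  ~ (forall z, sphere z ->
       expR (- u z / 2) <= a / s * (s ^+ 2 + 2 - 2 * dotp z x)).
Proof.
move=> Cu Sx tr a0 ac /andP[s0 s2] Ps.
have Pn n : 0 < s / 2 ^+ n <= 2 /\ forall z, sphere z ->
    expR (- u z / 2) <= a / (s / 2 ^+ n) * ((s / 2 ^+ n) ^+ 2 + 2 - 2 * dotp z x).
  elim: n => [|n [/andP[sn0 sn2] IH]]; first by rewrite expr0 divr1 s0 s2; split.
  have -> : s / 2 ^+ n.+1 = s / 2 ^+ n / 2 by rewrite exprSr invfM mulrA.
  split; first by rewrite divr_gt0 //=; lra.
  by apply: (bubble_halving Cu Sx tr a0 ac) => //; rewrite sn0.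
pose m := expR (- u x / 2).
have m0 : 0 < m by exact: expR_gt0.
have [n nP] : exists n : nat, a * s / m < n%:R.
  exists (Num.truncn (a * s / m)).+1; exact: truncnS_gt.
have [/andP[sn0 _] /(_ x Sx)] := Pn n.
rewrite ((sphereE x).1 Sx) -/m.
have -> : a / (s / 2 ^+ n) * ((s / 2 ^+ n) ^+ 2 + 2 - 2 * 1) = a * s / 2 ^+ n.
  have : 2 ^+ n != 0 :> R by rewrite expf_neq0.
  by move: (2 ^+ n) => k k0; field; rewrite k0 gt_eqF.
rewrite ler_pdivlMr ?exprn_gt0 // leNgt => /negP; apply.
rewrite [m * _]mulrC -ltr_pdivrMr //; apply: (lt_le_trans nP).
by rewrite -natrX ler_nat ltnW // ltn_expl.
Qed.

(** At either pole the barrier equals [1 - x.y], so [M / (1 - x.y)] bounds the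
    ratio there. *)
Lemma two_pole_bound u x y (p M : R) : 1 < p <= 2 -> Ck_sphere 2 u ->
  sphere x -> sphere y -> x != y ->
  (forall z e1 e2, orthoframe z e1 e2 ->
    0 < Atensor u z e1 e1 + (2 - p) * Atensor u z e2 e2) ->
  expR (- u x / 2) <= M -> expR (- u y / 2) <= M ->
  forall z, sphere z -> expR (- u z / 2)
    <= M / (1 - dotp x y) * two_pole ((p - 1) / 2) x y z.
Proof.
move=> /andP[p1 p2] Cu Sx Sy xy gam uxM uyM z Sz.
set b := (p - 1) / 2.
have b0 : 0 < b by rewrite divr_gt0 // subr_gt0.
have qE : 2 - p = 1 - 2 * b by rewrite /b; field.
have K0 : 0 < 1 - dotp x y by rewrite subr_gt0 dotp_sphere_lt1.
have W0 w : sphere w -> 0 < two_pole b x y w.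
  by move=> Sw; rewrite powR_gt0 // two_pole_base_gt0.
have [w Sw wmax] := sphere_ratio_max Cu
  (fun w Sw => continuous_two_pole b0 Sx Sy Sw xy) W0.
rewrite -ler_pdivrMr ?W0 //; apply: (le_trans (wmax z Sz)).
have pole_x : two_pole b x y x = 1 - dotp x y.
  rewrite /two_pole ((sphereE x).1 Sx) subrr normr0 powR0 ?gt_eqF // add0r.
  by rewrite -powRrM mulfV ?gt_eqF // powRr1 // gtr0_norm.
have pole_y : two_pole b x y y = 1 - dotp x y.
  rewrite /two_pole ((sphereE y).1 Sy) subrr normr0 powR0 ?gt_eqF // addr0.
  by rewrite -powRrM mulfV ?gt_eqF // powRr1 // gtr0_norm (dotpC y) ?K0.
have [->|wx] := eqVneq w x; first by rewrite pole_x ler_pM2r // invr_gt0.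
have [->|wy] := eqVneq w y; first by rewrite pole_y ler_pM2r // invr_gt0.
have b1 : 0 <= 1 - 2 * b by rewrite -qE subr_ge0.
have [e1 [e2 [F le0]]] := two_pole_touching Cu Sx Sy Sw xy wx wy b0 b1 wmax.
by have := gam _ _ _ F; rewrite qE ltNge le0.
Qed.

(** Here [m] is [|x - y|^2 + |z - x|^2], and [|z - y|^2 <= 2 m] by the
    parallelogram law. *)
Lemma two_pole_le (b : R) x y z : 0 < b -> sphere x -> sphere y -> sphere z ->
  two_pole b x y z <= 2 `^ b^-1 * (2 * (1 - dotp x y) + 2 * (1 - dotp z x)).
Proof.
move=> b0 Sx Sy Sz.
set m := 2 * (1 - dotp x y) + 2 * (1 - dotp z x).
have S0 : 0 <= 1 - dotp z x by rewrite subr_ge0 dotp_sphere_le1.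
have T0 : 0 <= 1 - dotp z y by rewrite subr_ge0 dotp_sphere_le1.
have K0 : 0 <= 1 - dotp x y by rewrite subr_ge0 dotp_sphere_le1.
have Sm : 1 - dotp z x <= m by rewrite /m; lra.
have Tm : 1 - dotp z y <= m.
  have := dotp_ge0 (z + y - 2 *: x).
  rewrite !(dotpDl, dotpDr, dotpNl, dotpNr, dotpZl, dotpZr).
  rewrite ((sphereE x).1 Sx) ((sphereE y).1 Sy) ((sphereE z).1 Sz).
  rewrite (dotpC y z) (dotpC x z) (dotpC y x) /m; lra.
have m0 : 0 <= m by exact: le_trans S0 Sm.
have -> : 2 `^ b^-1 * m = (2 * m `^ b) `^ b^-1.
  rewrite (powRM _ (ler0n R 2) (powR_ge0 m b)) -powRrM mulfV ?gt_eqF //.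
  by rewrite powRr1.
rewrite /two_pole (ger0_norm S0) (ger0_norm T0); apply: ge0_ler_powR.
- by rewrite invr_ge0 ltW.
- by rewrite nnegrE addr_ge0 // powR_ge0.
- by rewrite nnegrE mulr_ge0 // powR_ge0.
by rewrite mulr_natl mulr2n lerD //;
  apply: (ge0_ler_powR (ltW b0)); rewrite ?nnegrE.
Qed.

(** Otherwise [two_pole_bound] gives the hypothesis of [no_bubble_above] at the
    scale [s = |x - y|]; the constant is the one that [two_pole_le] requires.
    *)
Lemma two_point_separation u x y (p a c : R) : 1 < p <= 2 -> Ck_sphere 2 u ->
  sphere x -> sphere y -> x != y ->
  (forall z e1 e2, orthoframe z e1 e2 ->
    0 < Atensor u z e1 e1 + (2 - p) * Atensor u z e2 e2) ->
  (forall z e1 e2, orthoframe z e1 e2 ->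
    c * expR (u z) <= Atensor u z e1 e1 + Atensor u z e2 e2) ->
  0 < a -> 40 * a ^+ 2 < c -> u y <= u x ->
  a / (2 * 2 `^ ((p - 1) / 2)^-1) * enorm (y - x) < expR (- u y / 2).
Proof.
move=> p12 Cu Sx Sy xy gam tr a0 ac uyx.
have /andP[p1 p2] := p12.
have b0 : 0 < (p - 1) / 2 by rewrite divr_gt0 // subr_gt0.
set k := 2 `^ _.
have k0 : 0 < k by exact: powR_gt0.
set s := enorm (y - x).
have s0 : 0 < s by rewrite enorm_gt0 subr_eq0 eq_sym.
have s2E : s ^+ 2 = 2 * (1 - dotp x y).
  rewrite sqr_enorm !(dotpDl, dotpDr, dotpNl, dotpNr).
  rewrite ((sphereE x).1 Sx) ((sphereE y).1 Sy) (dotpC y x); ring.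
have s2 : s <= 2.
  rewrite -ler_sqr ?nnegrE ?(ltW s0) // s2E.
  have Sny : sphere (- y).
    by apply/sphereE; rewrite dotpNl dotpNr opprK; exact: (sphereE y).1.
  have := dotp_sphere_le1 Sny Sx; rewrite dotpNr; lra.
rewrite ltNge; apply/negP => uyM.
have uxM : expR (- u x / 2) <= a / (2 * k) * s.
  by apply: le_trans uyM; rewrite ler_expR ler_pM2r ?invr_gt0 // lerN2.
apply: (no_bubble_above Cu Sx tr a0 ac (_ : 0 < s <= 2)); first by rewrite s0.
move=> z Sz; apply: (le_trans (two_pole_bound p12 Cu Sx Sy xy gam uxM uyM Sz)).
have := two_pole_le b0 Sx Sy Sz; rewrite -/k -s2E.
have K0 : 0 < 1 - dotp x y by rewrite subr_gt0 dotp_sphere_lt1.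
have c0 : 0 < a / (2 * k) * s / (1 - dotp x y).
  by rewrite !(divr_gt0, mulr_gt0).
move=> H; apply: (le_trans (ler_wpM2l (ltW c0) H)).
have -> : 1 - dotp x y = s ^+ 2 / 2 by rewrite s2E; field.
rewrite le_eqVlt; apply/orP; left; apply/eqP.
by field; rewrite !gt_eqF.
Qed.

End separation.

(** * Riemannian versus chordal distance *)

Section distance.
Context {R : realType}.
Implicit Types (x y z v w : 'rV[R]_3).

Lemma continuous_enorm : continuous (@enorm R).
Proof.
move=> y; apply: (@continuous_comp _ _ _ (fun y => dotp y y) Num.sqrt).
  exact: continuous_sqr_dotp.
exact: sqrt_continuous.
Qed.

Lemma is_derive_dotp (c : R -> 'rV[R]_3) n (t : R) : derivable c t 1 ->
  is_derive t 1 (fun t => dotp (c t) n) (dotp (derive1 c t) n).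
Proof.
move=> dc; have dci i : is_derive t 1 (fun t => c t 0 i) (derive1 c t 0 i).
  have H := (derivable_mxP c t 1).1 dc 0 i.
  by apply: DeriveDef => //; rewrite derive1E derive_mx // mxE.
have -> : (fun t => dotp (c t) n) =
    (fun t => n 0 0 * c t 0 0 + n 0 1 * c t 0 1 + n 0 2 * c t 0 2).
  by apply/funext => s; rewrite dotpC dotpE.
rewrite dotpC dotpE.
have sc i := is_derive_scale (n 0 i) (dci i).
exact: is_deriveD (is_deriveD (sc 0) (sc 1)) (sc 2).
Qed.

(** The length of a curve is at least its displacement in any unit direction.
    *)
Lemma curve_length_ge (c : R -> 'rV[R]_3) n :
  (forall t : R, derivable c t 1) -> continuous (derive1 c) -> sphere n ->
  dotp (c 1) n - dotp (c 0) n
    <= \int[lebesgue_measure]_(t in `[0, 1]) enorm (derive1 c t).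
Proof.
move=> dc cc Sn.
have cd : continuous (fun t : R => dotp (derive1 c t) n).
  move=> t; apply: (@continuous_comp _ _ _ (derive1 c) (fun y => dotp y n)).
    exact: cc.
  exact: continuous_dotp.
have ce : continuous (fun t : R => enorm (derive1 c t)).
  move=> t; apply: (@continuous_comp _ _ _ (derive1 c) (@enorm R)).
    exact: cc.
  exact: continuous_enorm.
have F (t : R) := is_derive_dotp n (dc t).
have cF : continuous (fun t : R => dotp (c t) n).
  move=> t; have [d _] := F t.
  exact/differentiable_continuous/derivable1_diffP.
have -> : dotp (c 1) n - dotp (c 0) n =
    \int[lebesgue_measure]_(t in `[0, 1]) dotp (derive1 c t) n.
  rewrite /Rintegral (continuous_FTC2 (F := fun t => dotp (c t) n)) //.
  - exact: continuous_subspaceT.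
  - split; first by move=> t _; have [] := F t.
    + exact/cvg_at_right_filter/cF.
    + exact/cvg_at_left_filter/cF.
  - by move=> t _; rewrite derive1E; have [_ ->] := F t.
apply: le_Rintegral => //.
- apply: continuous_compact_integrable; first exact: segment_compact.
  exact: continuous_subspaceT.
- apply: continuous_compact_integrable; first exact: segment_compact.
  exact: continuous_subspaceT.
- by move=> t _; exact: dotp_le_enorm.
Qed.

(** With [h = th / 2], the chord is [2 sin h], and [sin h] is at least [h / 2]
    if [cos h >= 1/2], and at least [h / 4] otherwise because [h < 2]. *)
Lemma angle_le_chord (th : R) : 0 <= th <= pi ->
  th ^+ 2 <= 16 * (2 * (1 - cos th)).
Proof.
move=> /andP[t0 tpi]; pose h := th / 2.
have thE : th = h *+ 2 by rewrite /h -mulr_natr divfK.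
have h0 : 0 <= h by rewrite divr_ge0.
have hpi : h <= pi / 2 by rewrite ler_pM2r // invr_gt0.
have h2 : h < 2 := le_lt_trans hpi (pihalf_lt2 R).
have -> : cos th = 1 - 2 * sin h ^+ 2.
  by rewrite thE cos_mulr2n sin2cos2; ring.
suff hs : h ^+ 2 <= 16 * sin h ^+ 2.
  by rewrite {1}thE -mulr_natl exprMn; lra.
have [cge|clt] := leP (2^-1) (cos h).
  have [c cI] := MVT_segment h0 (fun s _ => is_derive_sin s)
    (continuous_subspaceT (@continuous_sin R)).
  rewrite sin0 !subr0 => ->.
  have cosc : 2^-1 <= cos c.
    apply: (le_trans cge); move: cI; rewrite in_itv /= => /andP[c0 ch].
    have pihalf_pi : pi / 2 <= pi :> R by have := pi_ge0 R; lra.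
    rewrite leNgt ltr_cos ?in_itv /= -?leNgt //; apply/andP; split=> //; lra.
  have : (2^-1 * h) ^+ 2 <= (cos c * h) ^+ 2.
    rewrite ler_sqr ?nnegrE ?ler_wpM2r // mulr_ge0 //.
    by apply: le_trans cosc; rewrite invr_ge0.
  rewrite exprMn; have := sqr_ge0 h; lra.
have c0 : 0 <= cos h.
  apply: cos_ge0_pihalf; rewrite hpi andbT; apply: le_trans h0.
  by rewrite oppr_le0 divr_ge0 // pi_ge0.
have : cos h ^+ 2 <= 2^-1 ^+ 2 by rewrite ler_sqr ?nnegrE ?invr_ge0 // ltW.
have : h ^+ 2 <= 2 ^+ 2 by rewrite ler_sqr ?nnegrE // ltW.
rewrite sin2cos2; lra.
Qed.

Lemma great_circle y e (th : R) : sphere y -> tangent y e -> dotp e e = 1 ->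
  0 <= th ->
  let c t := cos (th * t) *: y + sin (th * t) *: e in
  [/\ forall t, sphere (c t),
      (forall t : R, derivable c t 1) /\ continuous (derive1 c)
    & forall t, enorm (derive1 c t) = th].
Proof.
move=> /sphereE yy ye ee th0 c.
pose d t := - (th * sin (th * t)) *: y + (th * cos (th * t)) *: e.
have lin (t : R) : is_derive t 1 (fun t : R => th * t) th.
  by have := is_derive_scale th (is_derive_id t (1 : R)); rewrite mulr1.
have dcos (t : R) : is_derive t 1 (fun t => cos (th * t)) (- (th * sin (th * t))).
  have := @is_derive1_comp R cos (fun t => th * t) t _ _ (is_derive_cos _) (lin t).
  by rewrite mulNr mulrC.
have dsin (t : R) : is_derive t 1 (fun t => sin (th * t)) (th * cos (th * t)).
  have := @is_derive1_comp R sin (fun t => th * t) t _ _ (is_derive_sin _) (lin t).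
  by rewrite mulrC.
have dci (t : R) i : is_derive t 1 (fun t => c t 0 i) (d t 0 i).
  have -> : (fun t => c t 0 i) =
      (fun t => y 0 i * cos (th * t) + e 0 i * sin (th * t)).
    by apply/funext => s; rewrite !mxE ![_ * cos _]mulrC ![_ * sin _]mulrC.
  have -> : d t 0 i = y 0 i * - (th * sin (th * t)) + e 0 i * (th * cos (th * t)).
    by rewrite !mxE; ring.
  exact: is_deriveD (is_derive_scale _ (dcos t)) (is_derive_scale _ (dsin t)).
have dc (t : R) : derivable c t 1.
  by apply/derivable_mxP => i j; rewrite ord1; have [] := dci t j.
have cE : derive1 c = d.
  apply/funext => t; rewrite derive1E derive_mx //; apply/rowP => i; rewrite mxE.
  by have [_ ->] := dci t i.
split.
- move=> t; apply/sphereE; rewrite !(dotpDl, dotpDr, dotpZl, dotpZr) yy ee ye.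
  rewrite (dotpC e y) ye; rewrite -[RHS](cos2Dsin2 (th * t)); ring.
- split; first exact: dc.
  rewrite cE => t.
  have cl : {for t, continuous (fun t : R => th * t)}.
    by have [/derivable1_diffP/differentiable_continuous] := lin t.
  have cc : {for t, continuous (fun t => th * cos (th * t))}.
    apply: continuousM; first exact: cst_continuous.
    by apply: (@continuous_comp _ _ _ (fun t => th * t) cos) => //; exact: continuous_cos.
  have cs : {for t, continuous (fun t => - (th * sin (th * t)))}.
    apply: continuousN; apply: continuousM; first exact: cst_continuous.
    by apply: (@continuous_comp _ _ _ (fun t => th * t) sin) => //; exact: continuous_sin.
  have c1 : {for t, continuous (fun t => - (th * sin (th * t)) *: y)}.
    exact: continuousZr_tmp.
  have c2 : {for t, continuous (fun t => (th * cos (th * t)) *: e)}.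
    exact: continuousZr_tmp.
  exact: continuousD c1 c2.
move=> t; rewrite cE /enorm !(dotpDl, dotpDr, dotpZl, dotpZr) yy ee ye (dotpC e y) ye.
rewrite (_ : _ + _ = th ^+ 2 * (cos (th * t) ^+ 2 + sin (th * t) ^+ 2)); last by ring.
by rewrite cos2Dsin2 mulr1 sqrtr_sqr ger0_norm.
Qed.

(** The lower bound is needed to take logarithms: [ln] vanishes at 0, so a zero
    distance would turn the estimate into a bound on [u].  The upper bound is
    the length of a great circle. *)
Lemma sphere_dist_bounds x y : sphere x -> sphere y -> y != x ->
  0 < sphere_dist y x <= 4 * enorm (y - x).
Proof.
move=> Sx Sy yx; rewrite /sphere_dist; set E := [set L | _].
have xx := (sphereE x).1 Sx; have yy := (sphereE y).1 Sy.
have n0 : 0 < enorm (x - y) by rewrite enorm_gt0 subr_eq0 eq_sym.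
have lbE : lbound E (enorm (x - y)).
  move=> L [c [Sc [dc cc] c0 c1 ->]].
  have := curve_length_ge dc cc (sphere_retract (_ : x - y != 0)).
  rewrite c0 c1 -enorm_gt0 => /(_ n0); apply: le_trans.
  rewrite -dotpNl -dotpDl /retract dotpZr -sqr_enorm expr2 mulrA mulVf ?mul1r //.
  exact: lt0r_neq0.
pose k := dotp y x.
have k1 : -1 <= k <= 1.
  rewrite dotp_sphere_le1 // andbT lerNl.
  have Sny : sphere (- y) by apply/sphereE; rewrite dotpNl dotpNr opprK.
  by have := dotp_sphere_le1 Sx Sny; rewrite dotpNl.
pose th := acos k.
have thb : 0 <= th <= pi by rewrite acos_ge0 // acos_lepi.
have cth : cos th = k by rewrite acosK // in_itv.
have sth : sin th = Num.sqrt (1 - k ^+ 2) by exact: sin_acos.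
pose xi := x - k *: y.
have xiy : tangent y xi.
  by rewrite /tangent /= /xi dotpDr dotpNr dotpZr yy mulr1 subrr.
have xin : enorm xi = sin th.
  rewrite sth /enorm; congr Num.sqrt.
  rewrite /xi !(dotpDl, dotpDr, dotpNl, dotpNr, dotpZl, dotpZr) xx yy.
  rewrite (dotpC x y) -/k; ring.
have [e [ye ee xe]] : exists e, [/\ tangent y e, dotp e e = 1 & xi = sin th *: e].
  have [xi0|xi0] := eqVneq xi 0; last first.
    have [e1 [e2 [F xe]]] := orthoframe_exists Sy xiy xi0.
    by exists e1; rewrite -xin; have [_ ? _] := tangent_frame F; have [_ ? _ _] := F.
  have [v yv v0] := tangent_exists Sy.
  have [e1 [e2 [F _]]] := orthoframe_exists Sy yv v0.
  exists e1; have [_ ? _] := tangent_frame F; have [_ ? _ _] := F; split => //.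
  by rewrite -xin xi0 -(scale0r 0) enormZ // mul0r scale0r scale0r.
have [Sc dc lc] := great_circle Sy ye ee (andP thb).1.
have thE : E th.
  exists (fun t => cos (th * t) *: y + sin (th * t) *: e); split => //.
  - by rewrite mulr0 cos0 sin0 scale1r scale0r addr0.
  - by rewrite mulr1 cth -xe /xi addrC subrK.
  - under eq_Rintegral do rewrite lc.
    by rewrite Rintegral_cst //= lebesgue_measure_itv /= lte_fin ltr01 oppr0 adde0 mulr1.
apply/andP; split.
  by apply: (lt_le_trans n0); apply: lb_le_inf => //; exists th.
apply: (@le_trans _ _ th); first by apply: ge_inf => //; exists (enorm (x - y)).
rewrite -ler_sqr ?nnegrE ?mulr_ge0 ?sqrtr_ge0 ?(andP thb).1 //.
rewrite exprMn sqr_enorm; apply: (le_trans (angle_le_chord thb)).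
rewrite !(dotpDl, dotpDr, dotpNl, dotpNr) xx yy (dotpC x y) -/k cth.
by rewrite le_eqVlt; apply/orP; left; apply/eqP; ring.
Qed.

End distance.

(** * The estimate *)

(** By concavity and symmetry [f] is at most its value at the mean of [l] and
    its reflection, which lies on the diagonal, where [f] is linear by
    homogeneity. *)
Lemma trace_lower_bound (R : realType) (p : R) (f : R * R -> R) (l : R * R)
  (k : R) : p <= 2 ->
  (forall l1 l2 : R, closure (Gamma p) (l1, l2) -> f (l1, l2) = f (l2, l1)) ->
  (forall (s : R) (l : R * R), 0 < s -> closure (Gamma p) l ->
     f (s * l.1, s * l.2) = s * f l) ->
  (forall l : R * R, Gamma p l -> 0 < f l) ->
  (forall (a b : R * R) (t : R), Gamma p a -> Gamma p b -> 0 <= t <= 1 ->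
     t * f a + (1 - t) * f b
       <= f (t * a.1 + (1 - t) * b.1, t * a.2 + (1 - t) * b.2)) ->
  Gamma p l -> k <= f l -> 2 * k / f (1, 1) <= l.1 + l.2.
Proof.
move=> p2 f_sym f_hom f_pos f_conc Gl kf.
have G1 : Gamma p (1, 1) by rewrite /Gamma /=; split; lra.
have f1 := f_pos _ G1.
case: l Gl kf => l1 l2 [/= g1 g2] kf.
have G12 : Gamma p (l1, l2) by [].
have G21 : Gamma p (l2, l1) by [].
have s0 : 0 < 2^-1 * (l1 + l2).
  have : 0 < (3 - p) * (l1 + l2) by lra.
  by rewrite pmulr_rgt0 ?pmulr_rgt0 ?invr_gt0 //; lra.
have := f_conc _ _ 2^-1 G12 G21; rewrite /=.
rewrite -(f_sym l1 l2 (subset_closure G12)).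
have -> : 1 - 2^-1 = 2^-1 :> R by field.
rewrite -!mulrDr [l2 + l1]addrC.
have := f_hom (2^-1 * (l1 + l2)) (1, 1) s0 (subset_closure G1).
rewrite /= mulr1 => -> H.
rewrite ler_pdivrMr //; have : 0 <= (2^-1 : R) <= 1 by lra.
by move=> /H; lra.
Qed.
Theorem theorem4p2 (R : realType) (p : R) (hp : 1 < p <= 2)
  (f : R * R -> R)
  (f_C1 : Ck 1 (Gamma p) f)
  (f_C0 : {within closure (Gamma p), continuous f})
  (f_sym : forall l1 l2 : R,
     closure (Gamma p) (l1, l2) -> f (l1, l2) = f (l2, l1))
  (f_hom : forall (s : R) (l : R * R),
     0 < s -> closure (Gamma p) l -> f (s * l.1, s * l.2) = s * f l)
  (f_pos : forall l : R * R, Gamma p l -> 0 < f l)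
  (f_der : forall l : R * R, Gamma p l ->
     0 < 'D_((1, 0) : R * R) f l /\ 0 < 'D_((0, 1) : R * R) f l)
  (f_bd : forall l : R * R,
     (closure (Gamma p) `\` interior (Gamma p)) l -> f l = 0)
  (f_conc : forall (a b : R * R) (t : R),
     Gamma p a -> Gamma p b -> 0 <= t <= 1 ->
     t * f a + (1 - t) * f b
       <= f (t * a.1 + (1 - t) * b.1, t * a.2 + (1 - t) * b.2))
  (c1 C2 : R) (hc1 : 0 < c1) (hC2 : 0 < C2) :
  exists C : R, 0 < C /\
    forall (K : nat -> 'rV[R]_3 -> R) (u : nat -> 'rV[R]_3 -> R)
           (x : nat -> 'rV[R]_3),
      (forall i, Ck_sphere 2 (K i)) ->
      (forall i y, sphere y -> 0 < K i y) ->
      (forall i y, sphere y -> c1 <= K i y) ->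
      (forall i, (C2norm (K i) <= C2%:E)%E) ->
      (forall i, Ck_sphere 2 (u i)) ->
      (forall i y, sphere y ->
         exists l : R * R,
           [/\ eigenvalues_gA (u i) y l, Gamma p l & f l = K i y]) ->
      (forall i, sphere (x i)) ->
      (forall i y, sphere y -> u i y <= u i (x i)) ->
      (fun i => u i (x i)) @ \oo --> +oo ->
      forall i y, sphere y -> y != x i ->
        u i y <= - 2 * ln (sphere_dist y (x i)) + C.
Proof.
have /andP[p1 p2] := hp.
have G1 : Gamma p (1, 1) by rewrite /Gamma /=; split; lra.
have f1 := f_pos _ G1.
pose c := 2 * c1 / f (1, 1).
have c0 : 0 < c by rewrite divr_gt0 // mulr_gt0.
(* Any [a] with [40 a^2 < c] would do. *)
pose a := Num.sqrt c / 8.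
have a0 : 0 < a by rewrite divr_gt0 // sqrtr_gt0.
have ac : 40 * a ^+ 2 < c.
  by rewrite /a expr_div_n sqr_sqrtr ?(ltW c0) //; lra.
pose k := a / (2 * 2 `^ ((p - 1) / 2)^-1) / 4.
have k0 : 0 < k.
  rewrite divr_gt0 // divr_gt0 // mulr_gt0 // powR_gt0 //.
exists (`|2 * ln k| + 1); split; first by rewrite ltr_wpDl.
move=> K u x _ _ Kc1 _ Cu eq Sx xmax _ i y Sy yx.
have gam z e1 e2 : orthoframe z e1 e2 ->
    0 < Atensor (u i) z e1 e1 + (2 - p) * Atensor (u i) z e2 e2.
  move=> F; have [Sz _ _] := tangent_frame F.
  have [l [el Gl _]] := eq i z Sz.
  exact: Gamma_frame_gt0 hp (Cu i) F el Gl.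
have tr z e1 e2 : orthoframe z e1 e2 ->
    c * expR (u i z) <= Atensor (u i) z e1 e1 + Atensor (u i) z e2 e2.
  move=> F; have [Sz _ _] := tangent_frame F.
  have [l [el Gl fl]] := eq i z Sz.
  have [-> _] := eigenvalues_frame (Cu i) F el.
  rewrite mulrC ler_pM2l ?expR_gt0 //.
  apply: (trace_lower_bound p2 f_sym f_hom f_pos f_conc Gl).
  by rewrite fl; exact: Kc1.
have xy : x i != y by rewrite eq_sym.
have sep := two_point_separation hp (Cu i) (Sx i) Sy xy gam tr a0 ac (xmax i y Sy).
have /andP[d0 d4] := sphere_dist_bounds (Sx i) Sy yx.
have kd : k * sphere_dist y (x i) <= expR (- u i y / 2).
  apply: le_trans (ltW sep); apply: (le_trans (ler_wpM2l (ltW k0) d4)).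
  by rewrite mulrA /k divfK.
have : ln (k * sphere_dist y (x i)) <= - u i y / 2.
  have kd0 := mulr_gt0 k0 d0.
  by rewrite -[leRHS]expRK ler_ln ?posrE ?expR_gt0.
rewrite lnM ?posrE //.
have := ler_norm (- (2 * ln k)); rewrite normrN; lra.
Qed.
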